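(* For every $r\in\mathbb Z_{>0}$, $$\mathsf S_{4,r}\big(\mathsf H_k;2^4\big)\in\mathfrak Z_{r+2}(8)\qquad\text{and}\qquad\mathsf S_{4,r}\big(\mathsf H_k;2^2\big)\in\mathfrak Z_{r+2}(12).$$
   Context: $\mathsf H_m=\sum_{k=1}^m\frac1k$ are the harmonic numbers. For a sequence $(a_k)$ and a number $z$, $$\mathsf S_{4,r}(a_k;z)=\sum_{k=1}^\infty\frac{a_k z^k}{k^{r+1}\binom{4k}{2k}}.$$ Multiple polylogarithms: $\operatorname{Li}_{a_1,\dots,a_n}(z_1,\dots,z_n)=\sum_{\ell_1>\dots>\ell_n>0}\prod_{j=1}^n\frac{z_j^{\ell_j}}{\ell_j^{a_j}}$ (a convergent, possibly only conditionally convergent, series when all $z_j$ are roots of unity and $(a_1,z_1)\ne(1,1)$, summed with $\ell_1$ increasing to infinity). The $\mathbb Q$-vector space of cyclotomic multiple zeta values of weight $k\in\mathbb Z_{>0}$ and level $N\in\mathbb Z_{>0}$ is $$\mathfrak Z_k(N)=\operatorname{span}_{\mathbb Q}\Big\{\operatorname{Li}_{a_1,\dots,a_n}(z_1,\dots,z_n)\ :\ n\ge1,\ a_1,\dots,a_n\in\mathbb Z_{>0},\ z_1^N=\dots=z_n^N=1,\ (a_1,z_1)\ne(1,1),\ \textstyle\sum_{j=1}^n a_j=k\Big\}.$$ *)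

(* Defs.v *)
(* Stdlib's classical reals, with Coquelicot's complex numbers and series. *)
From Stdlib Require Import Reals QArith Qreals List.
From Coquelicot Require Import Coquelicot.

Open Scope C_scope.

Definition Csum (f : nat -> C) (m n : nat) : C :=
  sum_n_m (f : nat -> C_NormedModule) m n.

Definition harmonic (m : nat) : C := Csum (fun k => 1 / INR k) 1 m.

Definition S4_term (r : nat) (a : nat -> C) (z : C) (k : nat) : C :=
  a k * z ^ k / (INR k ^ (r + 1) * Binomial.C (4 * k) (2 * k)).

(* The series starts at k = 1, whereas [is_series] starts at index 0. *)
Definition is_S4 (r : nat) (a : nat -> C) (z s : C) : Prop :=
  is_series (fun j => S4_term r a z (S j) : C_NormedModule) s.

(* An index is the list of pairs (a_1, z_1), ..., (a_n, z_n); the truncation is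
   the sum over L >= l_1 > ... > l_n > 0 of prod_j z_j ^ l_j / l_j ^ a_j. *)
Fixpoint Li_trunc (w : list (nat * C)) (L : nat) : C :=
  match w with
  | nil => 1
  | (a, z) :: w' =>
      Csum (fun l => z ^ l / INR l ^ a * Li_trunc w' (pred l)) 1 L
  end.

(* Possibly conditionally convergent: only l_1 is sent to infinity, the inner
   sums being finite. *)
Definition is_Li (w : list (nat * C)) (v : C) : Prop :=
  filterlim (fun L => Li_trunc w L : C_NormedModule) eventually
    (locally (v : C_NormedModule)).

Definition weight (w : list (nat * C)) : nat := list_sum (map fst w).

Definition admissible (w : list (nat * C)) : Prop :=
  match w with
  | nil => False
  | p :: _ => p <> (1%nat, RtoC 1)
  end.

Definition cyclotomic_MZV (k N : nat) (v : C) : Prop :=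
  exists w : list (nat * C),
    admissible w
    /\ (forall (a : nat) (z : C), In (a, z) w -> (0 < a)%nat /\ z ^ N = 1)
    /\ weight w = k
    /\ is_Li w v.

Inductive Q_span (P : C -> Prop) : C -> Prop :=
  | Q_span_0 : Q_span P 0
  | Q_span_add (q : Q) (v x : C) :
      P v -> Q_span P x -> Q_span P (Q2R q * v + x).

Definition CMZV (k N : nat) : C -> Prop := Q_span (cyclotomic_MZV k N).

(* Main.v *)
Require Import Defs.
From Stdlib Require Import Reals QArith Qreals List Lra Lia Psatz.
From Coquelicot Require Import Coquelicot.

Open Scope C_scope.

(** The series is an iterated integral, and its endpoints and letters can be
arranged so that every word occurring in it converges.

Put [y = t (1 - t)].  The number [1 / (k binom(4k, 2k))] is the beta integral
[B(2k, 2k)], that is twice the integral of [y^(2k-1)] from 0 to 1/2.  As [y] is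
real on the line [Re t = 1/2], it is also twice the real part of the integral
from 0 to any point of that line ([Re_beta_poly]).  With [X = z y^2] this turns
the sum into

  [S = 2 Re] (integral along [t] of [sum_k (H_k / k^r) X^k  dlog (t / (1 - t))]).

Since [sum_k H_k X^k = - log (1 - X) / (1 - X)], the integrand is itself an
iterated integral in the forms [dlog X] and [dlog (1 - X)].  Now parametrize the
path by [s] in [0, 1] so that [t(1) = 0], that [Re t(0) = 1/2], and that all the
forms become integer combinations of [ds / s] and of
[sigma ds / (1 - sigma s)] with [sigma^N = 1]:

- for [z = 16, N = 8]: [t = (1 - s)^2 / (2 (1 + s^2))], with [t(0) = 1/2];
- for [z = 4, N = 12]: [t = (1 - i) (1 - s) / (2 (1 + i s))], with
  [t(0) = (1 - i) / 2].  In this parameter [t = 1/2] is the point [s = - i]; a path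
  between two roots of unity would lead to products of iterated integrals, and
  moving its end along the line [Re t = 1/2] to the point [s = 0] avoids them.

Integrating by parts transfers the integrations from the factor [X^k] to the
other side: the innermost form becomes [dlog (t / (1 - t))], which has no pole at
[s = 0], and the outermost one [dlog (1 - X)], which has no pole at [s = 1].
So every word is an admissible [Li] of weight [r + 2] and level [N], and
[S = - 2 Re V] where [V] is an integer combination of such values; complex
conjugation preserves the level.

The integration by parts is carried out on the truncations [k <= K], where all
sums over [k] are polynomials in [X]: an explicit primitive ([primitive],
[cder_primitive]) has the truncated integrand as its derivative up to an error
of size [O (H_K / (1 + K s^2))], whose integral is [O (H_K / sqrt K)]
([psum_estimate]).  This proves the convergence of the series together with its
value ([S4_harmonic_is_CMZV]).  The values at [s = 1] of the iterated integrals,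
which are power series in [s], come from the convergence of the admissible words
([admissible_Li_converges]) and Abel's limit theorem ([eval_lin_limit]). *)

(** * Limits of complex sequences *)

(** Equalities between sums are typed in an algebraic structure on [C], where
[ring] and [field] do not recognize them. *)
Ltac eqC := match goal with |- ?a = ?b => change (@eq C a b) end.

(** Convergence by components, so that the theory of real limits applies. *)
Definition Clim (u : nat -> C) (v : C) : Prop :=
  is_lim_seq (fun n => Re (u n)) (Re v) /\ is_lim_seq (fun n => Im (u n)) (Im v).

Lemma Clim_filterlim (u : nat -> C) (v : C) :
  Clim u v ->
  filterlim (u : nat -> C_NormedModule) eventually
    (locally (v : C_NormedModule)).
Proof.
  intros [H1 H2].
  apply is_lim_seq_spec in H1; apply is_lim_seq_spec in H2.
  apply filterlim_locally; intros eps.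
  generalize (filter_and _ _ (H1 eps) (H2 eps)).
  apply filter_imp; intros n [h1 h2].
  split; assumption.
Qed.

Lemma Clim_plus u v l m :
  Clim u l -> Clim v m -> Clim (fun n => u n + v n) (l + m).
Proof.
  intros [H1 H2] [H3 H4]; split; simpl; now apply is_lim_seq_plus'.
Qed.

Lemma Clim_scal u l c : Clim u l -> Clim (fun n => c * u n) (c * l).
Proof.
  intros [H1 H2]; split; simpl.
  - apply is_lim_seq_minus'; now apply (is_lim_seq_scal_l _ _ (Finite _)).
  - apply is_lim_seq_plus'; now apply (is_lim_seq_scal_l _ _ (Finite _)).
Qed.

Lemma Clim_const c : Clim (fun _ => c) c.
Proof. split; apply is_lim_seq_const. Qed.

Lemma im_le_Cmod c : (Rabs (Im c) <= Cmod c)%R.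
Proof.
  eapply Rle_trans; [ apply (Rmax_r (Rabs (fst c))) | apply Rmax_Cmod ].
Qed.

Lemma Clim_ext u v l : (forall n, u n = v n) -> Clim u l -> Clim v l.
Proof.
  intros E [H1 H2]; split.
  - apply (is_lim_seq_ext (fun n => Re (u n))); auto. intros n; now rewrite E.
  - apply (is_lim_seq_ext (fun n => Im (u n))); auto. intros n; now rewrite E.
Qed.

Lemma is_lim_seq_0_dominated (u b : nat -> R) :
  (forall n, (Rabs (u n) <= b n)%R) -> is_lim_seq b 0%R -> is_lim_seq u 0%R.
Proof.
  intros H Hb. apply is_lim_seq_abs_0.
  apply (is_lim_seq_le_le (fun _ => 0%R) _ b).
  - intros n; split; [ apply Rabs_pos | apply H ].
  - apply is_lim_seq_const.
  - exact Hb.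
Qed.

Lemma Clim_0 (u : nat -> C) (b : nat -> R) :
  (forall n, (Cmod (u n) <= b n)%R) -> is_lim_seq b 0%R -> Clim u 0.
Proof.
  intros H Hb; split; (eapply is_lim_seq_0_dominated; [ | exact Hb ]); intros n.
  - eapply Rle_trans; [ apply re_le_Cmod | apply H ].
  - eapply Rle_trans; [ apply im_le_Cmod | apply H ].
Qed.

Lemma is_lim_seq_comp_filterlim (f : R -> R) (l : R) (F : (R -> Prop) -> Prop) (x : nat -> R) :
  filterlim f F (locally l) -> filterlim x eventually F ->
  is_lim_seq (fun m => f (x m)) l.
Proof. intros Hf Hx. apply (filterlim_comp _ _ _ x f _ F); auto. Qed.

Lemma Re_sum_n u n : Re (sum_n u n) = sum_n (fun k => Re (u k)) n.
Proof.
  induction n; [ now rewrite !sum_O | ].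
  rewrite !sum_Sn, <- IHn. reflexivity.
Qed.

Lemma Im_sum_n u n : Im (sum_n u n) = sum_n (fun k => Im (u k)) n.
Proof.
  induction n; [ now rewrite !sum_O | ].
  rewrite !sum_Sn, <- IHn. reflexivity.
Qed.

Lemma Clim_series_abs (d : nat -> C) (b : nat -> R) :
  (forall n, (Cmod (d n) <= b n)%R) -> ex_series b ->
  exists v, Clim (sum_n d) v.
Proof.
  intros H Hb.
  destruct (@ex_series_le R_AbsRing R_CompleteNormedModule (fun n => Re (d n)) b) as [x Hx]; auto.
  { intros n; eapply Rle_trans; [ apply re_le_Cmod | apply H ]. }
  destruct (@ex_series_le R_AbsRing R_CompleteNormedModule (fun n => Im (d n)) b) as [y Hy]; auto.
  { intros n; eapply Rle_trans; [ apply im_le_Cmod | apply H ]. }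
  exists (x, y); split.
  - eapply is_lim_seq_ext; [ intros n; symmetry; apply Re_sum_n | exact Hx ].
  - eapply is_lim_seq_ext; [ intros n; symmetry; apply Im_sum_n | exact Hy ].
Qed.

(** * Convergence of multiple polylogarithms at roots of unity *)

Open Scope R_scope.

(** The increment that makes [sqrt] a majorant stable under the nested summation
of [Cmod_Li_trunc]. *)
Lemma sqrt_step (l : nat) :
  / sqrt (INR l + 1) <= 3 * (sqrt (INR l + 2) - sqrt (INR l + 1)).
Proof.
  pose proof (pos_INR l).
  assert (Hx : 0 < sqrt (INR l + 1)) by (apply sqrt_lt_R0; lra).
  assert (Ex := sqrt_sqrt (INR l + 1) ltac:(lra)).
  assert (Ey := sqrt_sqrt (INR l + 2) ltac:(lra)).
  assert (Hxy : sqrt (INR l + 1) <= sqrt (INR l + 2)) by (apply sqrt_le_1; lra).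
  set (x := sqrt (INR l + 1)) in *; set (y := sqrt (INR l + 2)) in *.
  assert (y <= 2 * x) by nra.
  apply Rmult_le_reg_l with x; auto.
  rewrite Rinv_r by lra. nra.
Qed.

Lemma ex_series_three_halves :
  ex_series (fun l : nat => / ((INR l + 1) * sqrt (INR l + 1))).
Proof.
  set (f := fun l : nat => / ((INR l + 1) * sqrt (INR l + 1))).
  assert (Hf : forall l, 0 <= f l).
  { intros l; pose proof (pos_INR l).
    left; apply Rinv_0_lt_compat, Rmult_lt_0_compat; [ lra | apply sqrt_lt_R0; lra ]. }
  (* telescoping, by comparison with the differences of 2 / sqrt *)
  assert (Hs : forall n, sum_n f n <= 3 - 2 * / sqrt (INR n + 1)).
  { induction n.
    - rewrite sum_O. unfold f. simpl INR. rewrite Rplus_0_l, sqrt_1. lra.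
    - rewrite sum_Sn. change plus with Rplus.
      eapply Rle_trans; [ apply Rplus_le_compat_r, IHn | ].
      unfold f; rewrite S_INR.
      pose proof (pos_INR n).
      assert (Hx : 0 < sqrt (INR n + 1)) by (apply sqrt_lt_R0; lra).
      assert (Ex := sqrt_sqrt (INR n + 1) ltac:(lra)).
      assert (Ey := sqrt_sqrt (INR n + 1 + 1) ltac:(lra)).
      assert (Hxy : sqrt (INR n + 1) <= sqrt (INR n + 1 + 1)) by (apply sqrt_le_1; lra).
      set (x := sqrt (INR n + 1)) in *; set (y := sqrt (INR n + 1 + 1)) in *.
      assert (E : / ((INR n + 1 + 1) * y) = / (y * y * y)) by (f_equal; rewrite Ey; ring).
      rewrite E.
      assert (G : 0 <= 2 * / x - 2 * / y - / (y * y * y)).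
      { replace (2 * / x - 2 * / y - / (y * y * y))
          with ((2 * y * y * (y - x) - x) * / (x * (y * y * y))) by (field; split; lra).
        apply Rmult_le_pos; [ | left; apply Rinv_0_lt_compat; repeat apply Rmult_lt_0_compat; lra ].
        assert ((y - x) * (y + x) = 1) by nra.
        assert (1 <= (y - x) * (2 * y)) by nra.
        nra. }
      lra. }
  destruct (ex_finite_lim_seq_incr (sum_n f) 3) as [v Hv].
  - intros n. rewrite sum_Sn. change plus with Rplus. specialize (Hf (S n)). lra.
  - intros n. eapply Rle_trans; [ apply Hs | ].
    assert (0 < / sqrt (INR n + 1)); [ | lra ].
    apply Rinv_0_lt_compat, sqrt_lt_R0. pose proof (pos_INR n); lra.
  - exists v. exact Hv.
Qed.
Open Scope C_scope.

Definition word := list (nat * C).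

(** The coefficients of the one-variable generating function of a word, in which
the variable records only the outermost index.  The empty word has the function
1, so that it can serve as the start of an iterated integral. *)
Definition term (w : word) (l : nat) : C :=
  match w, l with
  | nil, O => 1
  | nil, S _ => 0
  | _ :: _, O => 0
  | (a, z) :: w', S k => z ^ S k / INR (S k) ^ a * Li_trunc w' k
  end.

Definition is_word (N : nat) (w : word) : Prop :=
  forall a z, In (a, z) w -> (0 < a)%nat /\ z ^ N = 1.

Lemma is_word_cons N a z w :
  is_word N ((a, z) :: w) <-> ((0 < a)%nat /\ z ^ N = 1) /\ is_word N w.
Proof.
  split.
  - intros H; split; [ apply H; now left | intros b y Hb; apply H; now right ].
  - intros [H1 H2] b y [E | Hb]; [ injection E; intros; now subst | now apply H2 ].
Qed.

Lemma Li_trunc_sum w L : Li_trunc w L = sum_n (term w) L.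
Proof.
  destruct w as [ | [a z] w ]; induction L.
  - now rewrite sum_O.
  - rewrite sum_Sn, <- IHL. change plus with Cplus. simpl. ring.
  - rewrite sum_O. simpl. unfold Csum. rewrite sum_n_m_zero; [ reflexivity | lia ].
  - rewrite sum_Sn, <- IHL. simpl Li_trunc. unfold Csum.
    rewrite sum_n_Sm by lia. reflexivity.
Qed.

Lemma Li_trunc_S w L : Li_trunc w (S L) = Li_trunc w L + term w (S L).
Proof. rewrite !Li_trunc_sum, sum_Sn. reflexivity. Qed.

Lemma Cmod_root_of_unity N z : (0 < N)%nat -> z ^ N = 1 -> Cmod z = 1%R.
Proof.
  intros HN E.
  assert (F : (Cmod z ^ N = 1)%R) by (rewrite <- Cmod_pow, E; apply Cmod_1).
  destruct (Rtotal_order (Cmod z) 1) as [H | [H | H]]; auto; exfalso.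
  - assert (Cmod z ^ N < 1)%R; [ | lra ].
    destruct N; [ lia | ]. simpl.
    pose proof (Cmod_ge_0 z).
    assert (Cmod z ^ N <= 1)%R.
    { rewrite <- (pow1 N). apply pow_incr; lra. }
    assert (0 <= Cmod z ^ N)%R by now apply pow_le.
    nra.
  - pose proof (Rlt_pow_R1 (Cmod z) N H HN). lra.
Qed.

Lemma Cmod_INR k : Cmod (INR k) = INR k.
Proof. rewrite Cmod_R. apply Rabs_pos_eq, pos_INR. Qed.

Lemma Cmod_term_cons N a z w k :
  (0 < N)%nat -> z ^ N = 1 -> (0 < a)%nat ->
  (Cmod (term ((a, z) :: w) (S k)) <= / (INR k + 1) * Cmod (Li_trunc w k))%R.
Proof.
  intros HN Hz Ha. cbn [term].
  assert (Hk : (1 <= INR (S k))%R) by (rewrite S_INR; pose proof (pos_INR k); lra).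
  rewrite Cmod_mult, Cmod_div, !Cmod_pow, (Cmod_root_of_unity N z), pow1, Cmod_INR; auto.
  2:{ apply Cpow_nz. intros E. apply RtoC_inj in E. lra. }
  apply Rmult_le_compat_r; [ apply Cmod_ge_0 | ].
  unfold Rdiv; rewrite Rmult_1_l. rewrite <- S_INR.
  set (x := INR (S k)) in *.
  apply Rinv_le_contravar; [ lra | ].
  destruct a; [ lia | ]. simpl pow.
  rewrite <- (Rmult_1_r x) at 1.
  apply Rmult_le_compat_l; [ lra | ]. now apply pow_R1_Rle.
Qed.

(** The growth is at most that of a power of [ln L]; any power of [L] with exponent
below 1 is enough for the uses below, and [sqrt] keeps the induction elementary. *)
Lemma Cmod_Li_trunc N w L :
  (0 < N)%nat -> is_word N w ->
  (Cmod (Li_trunc w L) <= 3 ^ length w * sqrt (INR L + 1))%R.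
Proof.
  intros HN. revert L. induction w as [ | [a z] w IH ]; intros L Hw.
  - simpl Li_trunc. rewrite Cmod_1. simpl length. simpl pow. rewrite Rmult_1_l.
    rewrite <- sqrt_1 at 1. apply sqrt_le_1; pose proof (pos_INR L); lra.
  - apply is_word_cons in Hw. destruct Hw as [[Ha Hz] Hw].
    induction L.
    + rewrite Li_trunc_sum, sum_O. simpl term. rewrite Cmod_0.
      apply Rmult_le_pos; [ apply pow_le; lra | apply sqrt_pos ].
    + rewrite Li_trunc_sum, sum_Sn, <- Li_trunc_sum. change plus with Cplus.
      eapply Rle_trans; [ apply Cmod_triangle | ].
      eapply Rle_trans; [ apply Rplus_le_compat; [ apply IHL | apply (Cmod_term_cons N); auto ] | ].
      pose proof (pos_INR L).
      eapply Rle_trans; [ apply Rplus_le_compat_l, Rmult_le_compat_l, IH; auto | ].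
      { left; apply Rinv_0_lt_compat; lra. }
      pose proof (sqrt_step L) as Hs.
      assert (Hx : (0 < sqrt (INR L + 1))%R) by (apply sqrt_lt_R0; lra).
      assert (Ex := sqrt_sqrt (INR L + 1) ltac:(lra)).
      rewrite S_INR. replace (INR L + 1 + 1)%R with (INR L + 2)%R by ring.
      replace (/ (INR L + 1) * (3 ^ length w * sqrt (INR L + 1)))%R
        with (3 ^ length w * / sqrt (INR L + 1))%R.
      2:{ rewrite <- Ex at 2. field. lra. }
      simpl length. simpl pow.
      assert (0 < 3 ^ length w)%R by (apply pow_lt; lra). nra.
Qed.

Lemma Cmod_term N w k :
  (0 < N)%nat -> is_word N w ->
  (Cmod (term w (S k)) <= 3 ^ length w * / sqrt (INR k + 1))%R.
Proof.
  intros HN Hw. pose proof (pos_INR k).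
  assert (Hx : (0 < sqrt (INR k + 1))%R) by (apply sqrt_lt_R0; lra).
  assert (Ex := sqrt_sqrt (INR k + 1) ltac:(lra)).
  assert (Hi : (0 < / sqrt (INR k + 1))%R) by now apply Rinv_0_lt_compat.
  destruct w as [ | [a z] w ].
  - simpl term. rewrite Cmod_0. simpl length. simpl pow. lra.
  - apply is_word_cons in Hw. destruct Hw as [[Ha Hz] Hw].
    eapply Rle_trans; [ apply (Cmod_term_cons N); auto | ].
    eapply Rle_trans.
    { apply Rmult_le_compat_l; [ left; apply Rinv_0_lt_compat; lra | apply (Cmod_Li_trunc N); auto ]. }
    replace (/ (INR k + 1) * (3 ^ length w * sqrt (INR k + 1)))%R
      with (3 ^ length w * / sqrt (INR k + 1))%R.
    2:{ rewrite <- Ex at 2. field. lra. }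
    apply Rmult_le_compat_r; [ lra | ]. apply Rle_pow; [ lra | simpl; lia ].
Qed.

Lemma is_lim_seq_inv_sqrt : is_lim_seq (fun k => / sqrt (INR k + 1))%R 0%R.
Proof.
  apply is_lim_seq_spec. intros eps. pose proof (cond_pos eps) as He.
  destruct (nfloor_ex (/ (eps * eps))) as [n Hn].
  { left; apply Rinv_0_lt_compat; nra. }
  exists n. intros k Hk. apply le_INR in Hk.
  pose proof (pos_INR k).
  assert (Hx : (0 < sqrt (INR k + 1))%R) by (apply sqrt_lt_R0; lra).
  assert (Ex := sqrt_sqrt (INR k + 1) ltac:(lra)).
  rewrite Rminus_0_r, Rabs_pos_eq by (left; now apply Rinv_0_lt_compat).
  assert (G : (/ (eps * eps) < sqrt (INR k + 1) * sqrt (INR k + 1))%R) by lra.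
  set (x := sqrt (INR k + 1)) in *.
  apply Rmult_lt_reg_r with x; auto. rewrite Rinv_l by lra.
  apply Rmult_lt_compat_l with (r := (eps * eps)%R) in G; [ | nra ].
  rewrite Rinv_r in G by nra.
  assert (0 < eps * x)%R by nra. nra.
Qed.

(** As [z^k = (z^(k+1) - z^k) / (z - 1)], a summation by parts moves the
difference to [g] and leaves an absolutely convergent series. *)
Lemma Clim_summation_by_parts (z : C) (g : nat -> C) (c : R) :
  Cmod z = 1%R -> z <> 1 ->
  (forall k, (Cmod (g k) <= c * / sqrt (INR k + 1))%R) ->
  (forall k, (Cmod (g (S k) - g k)%C <= c * / ((INR k + 1) * sqrt (INR k + 1)))%R) ->
  exists v, Clim (sum_n (fun k => z ^ k * g k)) v.
Proof.
  intros Hz Hz1 Hg Hd.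
  assert (Hz2 : z - 1 <> 0) by now apply Cminus_eq_contra.
  assert (E : forall n, sum_n (fun k => z ^ k * g k) n =
     / (z - 1) * (z ^ S n * g (S n) + - g O)
     + - / (z - 1) * sum_n (fun k => z ^ S k * (g (S k) - g k)) n).
  { induction n.
    - rewrite !sum_O. simpl. field. auto.
    - rewrite !sum_Sn, IHn. change plus with Cplus. simpl Cpow. eqC. field. auto. }
  destruct (Clim_series_abs (fun k => z ^ S k * (g (S k) - g k))
              (fun k => (c * / ((INR k + 1) * sqrt (INR k + 1)))%R)) as [v Hv].
  { intros k. rewrite Cmod_mult, Cmod_pow, Hz, pow1, Rmult_1_l. apply Hd. }
  { apply (@ex_series_scal R_AbsRing R_NormedModule c). apply ex_series_three_halves. }
  exists (/ (z - 1) * (0 + - g O) + - / (z - 1) * v).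
  eapply Clim_ext; [ intros n; symmetry; apply E | ].
  apply Clim_plus; apply Clim_scal; auto.
  apply Clim_plus; [ | apply Clim_const ].
  apply Clim_0 with (fun k => (c * / sqrt (INR (S k) + 1))%R).
  - intros k. rewrite Cmod_mult, Cmod_pow, Hz, pow1, Rmult_1_l. apply Hg.
  - replace (Finite 0%R) with (Rbar_mult c 0%R) by (simpl; f_equal; ring).
    apply is_lim_seq_scal_l.
    apply (is_lim_seq_incr_1 (fun k => / sqrt (INR k + 1)))%R. apply is_lim_seq_inv_sqrt.
Qed.

Lemma INR_S_neq_0 k : RtoC (INR (S k)) <> 0.
Proof. intros E. apply RtoC_inj in E. revert E. apply not_0_INR. lia. Qed.

(** Admissibility leaves two cases: the outermost exponent is at least 2, and
the series converges absolutely, or it is 1 and the outermost root of unity is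
not 1, and the powers of that root oscillate. *)
Lemma admissible_Li_converges N w :
  (0 < N)%nat -> is_word N w -> admissible w ->
  exists v, Clim (Li_trunc w) v.
Proof.
  intros HN Hw Ha. destruct w as [ | [a z] w ]; [ easy | ].
  assert (Hw' := Hw). apply is_word_cons in Hw'. destruct Hw' as [[Ha0 Hz] Hw'].
  assert (Hz1 := Cmod_root_of_unity N z HN Hz).
  (* The term of index 0 vanishes; a shifted index is invertible. *)
  assert (G : exists v, Clim (sum_n (fun k => term ((a, z) :: w) (S k))) v).
  2:{ destruct G as [v [H1 H2]]. exists v.
      assert (E : forall n, sum_n (fun k => term ((a, z) :: w) (S k)) n
                  = Li_trunc ((a, z) :: w) (S n)).
      { induction n.
        - rewrite sum_O, Li_trunc_S, Li_trunc_sum, sum_O. simpl. ring.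
        - now rewrite sum_Sn, IHn, (Li_trunc_S _ (S n)). }
      split; apply is_lim_seq_incr_1.
      - apply (is_lim_seq_ext (fun n => Re (sum_n (fun k => term ((a, z) :: w) (S k)) n))); auto.
        intros n; now rewrite E.
      - apply (is_lim_seq_ext (fun n => Im (sum_n (fun k => term ((a, z) :: w) (S k)) n))); auto.
        intros n; now rewrite E. }
  set (c := (3 ^ length w)%R).
  assert (Hc : (0 < c)%R) by (apply pow_lt; lra).
  assert (HT := fun k => Cmod_Li_trunc N w k HN Hw').
  assert (Hf := fun k => Cmod_term N w k HN Hw').
  fold c in HT, Hf.
  assert (Hk : forall k, exists x, (0 < x /\ INR k + 1 = x * x /\ sqrt (INR k + 1) = x)%R).
  { intros k. pose proof (pos_INR k). exists (sqrt (INR k + 1)). split; [ | split; auto ].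
    - apply sqrt_lt_R0; lra.
    - symmetry; apply sqrt_sqrt; lra. }
  destruct (Nat.eq_dec a 1) as [-> | Ha1].
  - (* Only the oscillation of the powers of z makes this series converge. *)
    assert (Hz2 : z <> 1) by (intros ->; now apply Ha).
    set (g := fun k => Li_trunc w k / INR (S k)).
    destruct (Clim_summation_by_parts z g (2 * c)) as [v Hv]; auto.
    + intros k. unfold g. rewrite Cmod_div by apply INR_S_neq_0.
      rewrite Cmod_INR, S_INR. specialize (HT k).
      destruct (Hk k) as [x [Hx [E1 E2]]]. rewrite E2 in *. rewrite E1.
      replace (2 * c * / x)%R with ((2 * c * x) / (x * x))%R by (field; lra).
      apply Rmult_le_compat_r; [ left; apply Rinv_0_lt_compat; nra | nra ].
    + intros k.
      assert (E : g (S k) - g k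
                  = (term w (S k) - Li_trunc w k / INR (S k)) / INR (S (S k))).
      { unfold g. rewrite Li_trunc_S. rewrite (S_INR (S k)), RtoC_plus.
        field. split; [ | rewrite <- RtoC_plus, <- S_INR ]; apply INR_S_neq_0. }
      rewrite E, Cmod_div by apply INR_S_neq_0. rewrite Cmod_INR.
      assert (Hi : (/ INR (S (S k)) <= / (INR k + 1))%R).
      { rewrite !S_INR. pose proof (pos_INR k). apply Rinv_le_contravar; lra. }
      assert (Hm : (Cmod (term w (S k) - Li_trunc w k / INR (S k))%C <= 2 * c * / sqrt (INR k + 1))%R).
      { eapply Rle_trans; [ apply Cmod_triangle | ].
        rewrite Cmod_opp, Cmod_div by apply INR_S_neq_0. rewrite Cmod_INR, S_INR.
        specialize (HT k). specialize (Hf k).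
        destruct (Hk k) as [x [Hx [E1 E2]]]. rewrite E2 in *. rewrite E1.
        assert (Cmod (Li_trunc w k) / (x * x) <= c * / x)%R; [ | lra ].
        replace (c * / x)%R with ((c * x) / (x * x))%R by (field; lra).
        apply Rmult_le_compat_r; [ left; apply Rinv_0_lt_compat; nra | nra ]. }
      rewrite Rinv_mult. rewrite (Rmult_comm (/ (INR k + 1))), <- Rmult_assoc.
      apply Rmult_le_compat; auto; [ apply Cmod_ge_0 | ].
      left; apply Rinv_0_lt_compat, lt_0_INR; lia.
    + exists (z * v). apply Clim_scal with (c := z) in Hv.
      eapply Clim_ext; [ | exact Hv ]. intros n.
      induction n; [ rewrite !sum_O | rewrite !sum_Sn, <- IHn; change plus with Cplus ].
      * unfold g. simpl. field.
      * unfold g. cbn [term Cpow]. eqC. field. apply INR_S_neq_0.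
  - apply Clim_series_abs with (fun k => c * / ((INR k + 1) * sqrt (INR k + 1)))%R.
    + intros k. cbn [term].
      rewrite Cmod_mult, Cmod_div, !Cmod_pow, Hz1, pow1, Cmod_INR, S_INR
        by (apply Cpow_nz, INR_S_neq_0).
      specialize (HT k). pose proof (pos_INR k).
      assert (Hi : (1 / (INR k + 1) ^ a <= / ((INR k + 1) * (INR k + 1)))%R).
      { unfold Rdiv; rewrite Rmult_1_l. apply Rinv_le_contravar; [ nra | ].
        replace ((INR k + 1) * (INR k + 1))%R with ((INR k + 1) ^ 2)%R by ring.
        apply Rle_pow; [ lra | lia ]. }
      destruct (Hk k) as [x [Hx [E1 E2]]]. rewrite E2 in *. rewrite E1 in *.
      replace (c * / (x * x * x))%R with (/ (x * x * (x * x)) * (c * x))%R by (field; lra).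
      apply Rmult_le_compat; auto; [ | apply Cmod_ge_0 ].
      unfold Rdiv; rewrite Rmult_1_l. left; apply Rinv_0_lt_compat, pow_lt; nra.
    + apply (@ex_series_scal R_AbsRing R_NormedModule c). apply ex_series_three_halves.
Qed.

(** * Complex functions of a real variable *)

(** Everything is evaluated along real segments, so real differentiability of the
two components is all that is needed, also for power series with complex
coefficients. *)
Definition cder (f : R -> C) (s : R) (l : C) : Prop :=
  is_derive (fun x => Re (f x)) s (Re l) /\ is_derive (fun x => Im (f x)) s (Im l).

Lemma cder_ext f g s l : (forall x, f x = g x) -> cder f s l -> cder g s l.
Proof.
  intros E [H1 H2]; split.
  - apply (is_derive_ext (fun x => Re (f x))); auto. intros x; now rewrite E.
  - apply (is_derive_ext (fun x => Im (f x))); auto. intros x; now rewrite E.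
Qed.

Lemma cder_const c s : cder (fun _ => c) s 0.
Proof.
  split; [ exact (@is_derive_const R_AbsRing R_NormedModule (Re c) s)
         | exact (@is_derive_const R_AbsRing R_NormedModule (Im c) s) ].
Qed.

Lemma cder_RtoC s : cder RtoC s 1.
Proof.
  split; [ exact (@is_derive_id R_AbsRing s)
         | exact (@is_derive_const R_AbsRing R_NormedModule 0%R s) ].
Qed.

Lemma Re_minus a b : Re (a - b) = (Re a - Re b)%R.
Proof. reflexivity. Qed.

Lemma cder_plus f g s l m :
  cder f s l -> cder g s m -> cder (fun x => f x + g x) s (l + m).
Proof. intros [] []; split; now apply (@is_derive_plus R_AbsRing R_NormedModule). Qed.

Lemma is_derive_Rmult (f g : R -> R) (x l m : R) :
  is_derive f x l -> is_derive g x m ->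
  is_derive (fun y => f y * g y)%R x (l * g x + f x * m)%R.
Proof. intros; apply (is_derive_mult f g); auto. intros; apply Rmult_comm. Qed.

Lemma cder_mult f g s l m :
  cder f s l -> cder g s m -> cder (fun x => f x * g x) s (l * g s + f s * m).
Proof.
  intros [H1 H2] [H3 H4]; split.
  - replace (Re (l * g s + f s * m)) with
      ((Re l * Re (g s) + Re (f s) * Re m) - (Im l * Im (g s) + Im (f s) * Im m))%R
      by (unfold Re, Im; simpl; ring).
    apply (@is_derive_minus R_AbsRing R_NormedModule); now apply is_derive_Rmult.
  - replace (Im (l * g s + f s * m)) with
      ((Re l * Im (g s) + Re (f s) * Im m) + (Im l * Re (g s) + Im (f s) * Re m))%R
      by (unfold Re, Im; simpl; ring).
    apply (@is_derive_plus R_AbsRing R_NormedModule); now apply is_derive_Rmult.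
Qed.

Lemma cder_scal c f s l : cder f s l -> cder (fun x => c * f x) s (c * l).
Proof.
  intros H. replace (c * l) with (0 * f s + c * l) by ring.
  apply cder_mult; auto. apply cder_const.
Qed.

Lemma cder_opp f s l : cder f s l -> cder (fun x => - f x) s (- l).
Proof. intros []; split; now apply (@is_derive_opp R_AbsRing R_NormedModule). Qed.

Lemma cder_minus f g s l m :
  cder f s l -> cder g s m -> cder (fun x => f x - g x) s (l - m).
Proof. intros; apply cder_plus; auto. now apply cder_opp. Qed.

Lemma cder_pow f s l n :
  cder f s l -> cder (fun x => f x ^ S n) s (INR (S n) * f s ^ n * l).
Proof.
  intros H; induction n.
  - apply (cder_ext f); [ intros; simpl; ring | ].
    now replace (INR 1 * f s ^ 0 * l) with l by (simpl; ring).
  - replace (INR (S (S n)) * f s ^ S n * l) with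
      (l * f s ^ S n + f s * (INR (S n) * f s ^ n * l)).
    2:{ rewrite (S_INR (S n)), RtoC_plus. simpl Cpow. ring. }
    now apply (cder_mult f (fun x => f x ^ S n)).
Qed.

Lemma cder_real (f : R -> R) s l : is_derive f s l -> cder (fun x => RtoC (f x)) s (RtoC l).
Proof.
  intros H; split; [ exact H | ].
  exact (@is_derive_const R_AbsRing R_NormedModule 0%R s).
Qed.

(** The majorant of the derivative has the primitive [c atan (sqrt k s) / sqrt k],
whose variation is bounded independently of the interval. *)
Lemma mean_value_atan (f : R -> C) (df : R -> C) (c k u v : R) :
  (0 < k)%R -> (0 < u)%R -> (u < v)%R ->
  (forall s, (u <= s <= v)%R -> cder f s (df s)) ->
  (forall s, (u <= s <= v)%R -> (Cmod (df s) <= c * / (1 + k * s ^ 2))%R) ->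
  (0 <= c)%R ->
  (Rabs (Re (f v) - Re (f u)) <= 4 * c * / sqrt k)%R.
Proof.
  intros Hk Hu Huv Hf Hdf Hc.
  assert (Hq : (0 < sqrt k)%R) by now apply sqrt_lt_R0.
  assert (Ek := sqrt_sqrt k ltac:(lra)).
  set (at_ := fun s : R => (c * (atan (sqrt k * s) * / sqrt k))%R).
  assert (Ha : forall s, is_derive at_ s (c * / (1 + k * s ^ 2))%R).
  { intros s. unfold at_. auto_derive; auto.
    assert (0 <= s * s)%R by nra.
    replace (sqrt k * s * (sqrt k * s * 1))%R with (k * (s * s))%R by (rewrite <- Ek at 1; ring).
    field. split; [ simpl; nra | ]. nra. }
  assert (Hb : forall s, (Rabs (at_ s) <= c * 2 * / sqrt k)%R).
  { intros s. unfold at_. destruct (atan_bound (sqrt k * s)) as [B1 B2].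
    pose proof PI_4. assert (0 < / sqrt k)%R by now apply Rinv_0_lt_compat.
    rewrite !Rabs_mult, (Rabs_pos_eq c), (Rabs_pos_eq (/ sqrt k)) by lra.
    rewrite Rmult_assoc. apply Rmult_le_compat_l; auto. apply Rmult_le_compat_r; [ lra | ].
    apply Rabs_le. lra. }
  assert (Hmono : forall e, (e = 1 \/ e = -1)%R ->
    (at_ u + e * Re (f u) <= at_ v + e * Re (f v))%R).
  { intros e He.
    assert (Hd : forall s, (u <= s <= v)%R -> is_derive (fun s => at_ s + e * Re (f s))%R s
                   (c * / (1 + k * s ^ 2) + e * Re (df s))%R).
    { intros s Hs. apply (@is_derive_plus R_AbsRing R_NormedModule); auto.
      apply (is_derive_scal (fun s => Re (f s))). now apply Hf. }
    destruct (MVT_gen (fun s => at_ s + e * Re (f s))%R u v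
               (fun s => c * / (1 + k * s ^ 2) + e * Re (df s))%R) as [w [Hw Ew]].
    - intros s. rewrite Rmin_left, Rmax_right by lra. intros Hs. apply Hd. lra.
    - intros s. rewrite Rmin_left, Rmax_right by lra. intros Hs.
      apply continuity_pt_filterlim.
      exact (@ex_derive_continuous R_AbsRing R_NormedModule _ _ (ex_intro _ _ (Hd s Hs))).
    - rewrite Rmin_left, Rmax_right in Hw by lra.
      assert (Hn : (Rabs (Re (df w)) <= c * / (1 + k * w ^ 2))%R).
      { eapply Rle_trans; [ apply re_le_Cmod | now apply Hdf ]. }
      apply Rabs_le_between in Hn.
      assert (0 <= c * / (1 + k * w ^ 2) + e * Re (df w))%R by (destruct He as [-> | ->]; lra).
      nra. }
  assert (M1 := Hmono 1%R ltac:(auto)). assert (M2 := Hmono (-1)%R ltac:(auto)).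
  assert (Bu := Hb u). assert (Bv := Hb v).
  apply Rabs_le_between in Bu, Bv. apply Rabs_le. lra.
Qed.

(** * Power series with bounded complex coefficients *)

Definition cps (a : nat -> C) (s : R) : C :=
  (PSeries (fun l => Re (a l)) s, PSeries (fun l => Im (a l)) s).

Definition Cbounded (a : nat -> C) : Prop := exists B, forall l, (Cmod (a l) <= B)%R.

Lemma Clim_unique u l m : Clim u l -> Clim u m -> l = m.
Proof.
  intros [H1 H2] [H3 H4].
  apply is_lim_seq_unique in H1, H2, H3, H4.
  assert (E1 : Re l = Re m) by congruence.
  assert (E2 : Im l = Im m) by congruence.
  destruct l, m; simpl in *; congruence.
Qed.

Lemma CV_radius_of_bounded (a : nat -> R) B (s : R) :
  (forall l, Rabs (a l) <= B)%R -> (Rabs s < 1)%R -> Rbar_lt (Rabs s) (CV_radius a).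
Proof.
  intros H Hs. apply Rbar_lt_le_trans with 1%R; auto.
  apply CV_radius_bounded. exists B. intros n. now rewrite pow1, Rmult_1_r.
Qed.

Lemma cps_Clim a s :
  ex_pseries (fun l => Re (a l)) s -> ex_pseries (fun l => Im (a l)) s ->
  Clim (sum_n (fun l => a l * RtoC s ^ l)) (cps a s).
Proof.
  intros H1 H2. split.
  - apply (is_lim_seq_ext (sum_n (fun l => Re (a l) * s ^ l)%R)).
    + intros n. rewrite Re_sum_n. apply sum_n_ext. intros l.
      rewrite <- RtoC_pow. unfold Re, Im; simpl. ring.
    + exact (Series_correct _ (proj1 (ex_pseries_R (fun l => Re (a l)) s) H1)).
  - apply (is_lim_seq_ext (sum_n (fun l => Im (a l) * s ^ l)%R)).
    + intros n. rewrite Im_sum_n. apply sum_n_ext. intros l.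
      rewrite <- RtoC_pow. unfold Re, Im; simpl. ring.
    + exact (Series_correct _ (proj1 (ex_pseries_R (fun l => Im (a l)) s) H2)).
Qed.

Lemma bounded_radius a s :
  Cbounded a -> (Rabs s < 1)%R ->
  Rbar_lt (Rabs s) (CV_radius (fun l => Re (a l))) /\
  Rbar_lt (Rabs s) (CV_radius (fun l => Im (a l))).
Proof.
  intros [B HB] Hs; split; apply CV_radius_of_bounded with B; auto; intros l.
  - eapply Rle_trans; [ apply re_le_Cmod | apply HB ].
  - eapply Rle_trans; [ apply im_le_Cmod | apply HB ].
Qed.

Definition shift (a : nat -> C) (l : nat) : C := a (S l).

Definition cps_derive (a : nat -> C) (l : nat) : C := INR (S l) * a (S l).

Lemma cder_cps a s :
  Cbounded a -> (Rabs s < 1)%R ->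
  cder (cps a) s (cps (cps_derive a) s) /\
  Clim (sum_n (fun l => cps_derive a l * RtoC s ^ l)) (cps (cps_derive a) s).
Proof.
  intros Ha Hs. destruct (bounded_radius a s Ha Hs) as [H1 H2].
  assert (E1 : forall l, PS_derive (fun l => Re (a l)) l = Re (cps_derive a l)).
  { intros l. unfold PS_derive, cps_derive. unfold Re, Im. cbn [fst snd Cmult RtoC]. ring. }
  assert (E2 : forall l, PS_derive (fun l => Im (a l)) l = Im (cps_derive a l)).
  { intros l. unfold PS_derive, cps_derive. unfold Re, Im. cbn [fst snd Cmult RtoC]. ring. }
  split; [ split | ].
  - cbn [cps Re fst]. rewrite <- (PSeries_ext _ _ s E1). now apply is_derive_PSeries.
  - cbn [cps Im snd]. rewrite <- (PSeries_ext _ _ s E2). now apply is_derive_PSeries.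
  - apply cps_Clim.
    + apply (ex_pseries_ext _ _ s E1). now apply ex_pseries_derive.
    + apply (ex_pseries_ext _ _ s E2). now apply ex_pseries_derive.
Qed.

Lemma cps_bounded_Clim a s :
  Cbounded a -> (Rabs s < 1)%R -> Clim (sum_n (fun l => a l * RtoC s ^ l)) (cps a s).
Proof.
  intros Ha Hs. destruct (bounded_radius a s Ha Hs) as [H1 H2].
  apply cps_Clim; now apply CV_radius_inside.
Qed.

Lemma bounded_shift a : Cbounded a -> Cbounded (shift a).
Proof. intros [B HB]; exists B; intros l; apply HB. Qed.

Lemma cps_shift a s :
  Cbounded a -> (Rabs s < 1)%R -> a O = 0 -> cps a s = s * cps (shift a) s.
Proof.
  intros Ha Hs E0.
  destruct (cps_bounded_Clim a s Ha Hs) as [H1 H2].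
  assert (K := cps_bounded_Clim (shift a) s (bounded_shift a Ha) Hs).
  apply Clim_scal with (c := RtoC s) in K.
  apply Clim_unique with (fun n => sum_n (fun l => a l * RtoC s ^ l) (S n)).
  - split; now apply (is_lim_seq_incr_1 (fun n => _ (sum_n (fun l => a l * RtoC s ^ l) n))).
  - eapply Clim_ext; [ | exact K ]. intros n. cbv beta.
    induction n.
    + rewrite sum_Sn, !sum_O, E0. change plus with Cplus. unfold shift. simpl. ring.
    + rewrite sum_Sn, (sum_Sn _ (S n)), <- IHn. change plus with Cplus.
      unfold shift. simpl Cpow. eqC. ring.
Qed.

Lemma Cmod_le_Re_Im c : (Cmod c <= Rabs (Re c) + Rabs (Im c))%R.
Proof.
  replace c with (RtoC (Re c) + Ci * RtoC (Im c)) at 1.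
  2:{ destruct c; unfold Ci, RtoC, Cmult, Cplus; simpl; f_equal; ring. }
  eapply Rle_trans; [ apply Cmod_triangle | ].
  rewrite Cmod_mult, Cmod_Ci, !Cmod_R. lra.
Qed.

(** The factor 2 comes from bounding the two components separately. *)
Lemma Cmod_Clim_le u l B :
  Clim u l -> (forall n, (Cmod (u n) <= B)%R) -> (Cmod l <= 2 * B)%R.
Proof.
  intros [H1 H2] H.
  eapply Rle_trans; [ apply Cmod_le_Re_Im | ].
  assert (K : forall (v : nat -> R) (x : R), is_lim_seq v x ->
             (forall n, Rabs (v n) <= B)%R -> (Rabs x <= B)%R).
  { intros v x Hv Hb. apply is_lim_seq_abs in Hv.
    apply (is_lim_seq_le _ _ _ _ Hb Hv (is_lim_seq_const B)). }
  apply K in H1; [ | intros n; eapply Rle_trans; [ apply re_le_Cmod | apply H ] ].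
  apply K in H2; [ | intros n; eapply Rle_trans; [ apply im_le_Cmod | apply H ] ].
  lra.
Qed.

Lemma Cmod_cps a :
  Cbounded a -> exists B, forall s : R, (0 <= s < 1)%R ->
  (Cmod (cps a s) <= B * / (1 - s))%R.
Proof.
  intros Ha. destruct (Ha) as [B HB]. exists (2 * B)%R. intros s Hs.
  rewrite Rmult_assoc.
  assert (H0 : (0 <= B)%R) by (eapply Rle_trans; [ apply Cmod_ge_0 | apply (HB O) ]).
  apply Cmod_Clim_le with (sum_n (fun l => a l * RtoC s ^ l)).
  - apply cps_bounded_Clim; auto. rewrite Rabs_pos_eq; lra.
  - intros n.
    apply Rle_trans with (B * ((1 - s ^ S n) * / (1 - s)))%R.
    + induction n.
      * rewrite sum_O. simpl. rewrite Cmult_1_r.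
        replace (B * ((1 - s * 1) * / (1 - s)))%R with B by (field; lra). auto.
      * rewrite sum_Sn. change plus with Cplus.
        eapply Rle_trans; [ apply Cmod_triangle | ].
        eapply Rle_trans; [ apply Rplus_le_compat_r, IHn | ].
        rewrite Cmod_mult, Cmod_pow, Cmod_R, (Rabs_pos_eq s) by lra.
        assert (0 <= s ^ S n)%R by (apply pow_le; lra).
        specialize (HB (S n)).
        replace (B * ((1 - s ^ S (S n)) * / (1 - s)))%R
          with (B * ((1 - s ^ S n) * / (1 - s)) + B * s ^ S n)%R by (simpl; field; lra).
        nra.
    + apply Rmult_le_compat_l; auto.
      assert (0 < / (1 - s))%R by (apply Rinv_0_lt_compat; lra).
      assert (0 <= s ^ S n)%R by (apply pow_le; lra). nra.
Qed.

(** Abel's theorem if the radius of convergence is 1, continuity if it is larger. *)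
Lemma Abel_limit (a : nat -> R) (V : R) :
  is_lim_seq (sum_n a) V -> filterlim (PSeries a) (at_left 1) (locally V).
Proof.
  intros H.
  assert (Hs : is_pseries a 1 V).
  { apply (is_pseries_R a 1 V). apply (is_series_ext a); auto. intros n. rewrite pow1. symmetry; apply Rmult_1_r. }
  assert (HV : PSeries a 1 = V) by now apply is_pseries_unique.
  assert (Hex : ex_pseries a 1) by now exists V.
  assert (Hr : Rbar_le 1 (CV_radius a)).
  { destruct (Rbar_le_lt_dec 1 (CV_radius a)) as [ | Hlt ]; auto. exfalso.
    apply (CV_disk_outside a 1).
    - rewrite Rabs_R1; auto.
    - apply ex_series_lim_0. exists V. apply is_series_ext with a; auto. intros n. rewrite pow1. symmetry; apply Rmult_1_r. }
  destruct (Rbar_le_lt_or_eq_dec _ _ Hr) as [Hlt | Heq].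
  - assert (Hc : continuity_pt (PSeries a) 1).
    { apply PSeries_continuity. now rewrite Rabs_R1. }
    apply continuity_pt_filterlim in Hc. rewrite HV in Hc.
    eapply filterlim_filter_le_1; [ | exact Hc ].
    intros P HP. now apply filter_le_within.
  - assert (E : real (CV_radius a) = 1%R) by now rewrite <- Heq.
    assert (K := Abel a). rewrite E, <- Heq, HV in K. apply K; simpl; auto; lra.
Qed.

(** * Words as iterated integrals *)

(** The letter [Zero] stands for [dlog s] and [Pole sigma] for
[- dlog (1 - sigma s)], which has its pole at the inverse of [sigma]. *)
Inductive letter := Zero | Pole (sigma : C).

Definition eta (x : letter) (s : R) : C :=
  match x with Zero => / s | Pole sigma => sigma / (1 - sigma * s) end.

(** Integration of a generating function against a letter.  In [Li] the powers of
the arguments are attached to the summation indices, in an iterated integral to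
their differences; hence the division of the next argument by [sigma].  The
value for [Zero] and the empty word is a placeholder, as [ds / s] is not
integrable at 0. *)
Definition prepend (x : letter) (w : word) : word :=
  match x, w with
  | Zero, nil => nil
  | Zero, (a, z) :: w' => (S a, z) :: w'
  | Pole sigma, nil => (1%nat, sigma) :: nil
  | Pole sigma, (a, z) :: w' => (1%nat, sigma) :: (a, z / sigma) :: w'
  end.

Definition is_letter (N : nat) (x : letter) : Prop :=
  match x with Zero => True | Pole sigma => sigma ^ N = 1 end.

Definition li (w : word) (s : R) : C := cps (term w) s.

Lemma root_of_unity_neq_0 N (z : C) : (0 < N)%nat -> z ^ N = 1 -> z <> 0.
Proof.
  intros HN E ->. assert (F := Cmod_root_of_unity N 0 HN E). rewrite Cmod_0 in F. lra.
Qed.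

Lemma one_minus_neq_0 N sigma (s : R) :
  (0 < N)%nat -> sigma ^ N = 1 -> (0 <= s < 1)%R -> 1 - sigma * s <> 0.
Proof.
  intros HN Hx Hs E.
  assert (E' : sigma * s = 1) by (rewrite <- (Cplus_0_r (sigma * s)), <- E; ring).
  assert (F : Cmod (sigma * s) = 1%R) by (rewrite E'; apply Cmod_1).
  rewrite Cmod_mult, (Cmod_root_of_unity N sigma HN Hx), Cmod_R, Rabs_pos_eq in F; lra.
Qed.

Lemma is_word_prepend N x w :
  (0 < N)%nat -> is_letter N x -> is_word N w -> is_word N (prepend x w).
Proof.
  intros HN Hx Hw. destruct x as [ | sigma ], w as [ | [a z] w ]; simpl in *.
  - exact Hw.
  - apply is_word_cons in Hw. apply is_word_cons. destruct Hw as [[]]. split; [ split | ]; auto.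
  - apply is_word_cons. auto.
  - apply is_word_cons in Hw. destruct Hw as [[]].
    assert (sigma <> 0) by now apply (root_of_unity_neq_0 N).
    apply is_word_cons; split; auto. apply is_word_cons. split; [ split | ]; auto.
    unfold Cdiv. rewrite Cpow_mult_l, Cpow_inv, Hx by auto. rewrite H0. field.
Qed.

Lemma weight_prepend x w :
  (x = Zero -> w <> nil) -> weight (prepend x w) = S (weight w).
Proof. destruct x, w as [ | [a z] w ]; simpl; auto; intros H; now destruct H. Qed.

Lemma bounded_term N w : (0 < N)%nat -> is_word N w -> Cbounded (term w).
Proof.
  intros HN Hw. exists (3 ^ length w)%R.
  assert (H1 : (1 <= 3 ^ length w)%R) by (apply pow_R1_Rle; lra).
  intros [ | k ].
  - destruct w as [ | [a z] w ]; simpl term; rewrite ?Cmod_1, ?Cmod_0; lra.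
  - eapply Rle_trans; [ apply (Cmod_term N); auto | ].
    rewrite <- (Rmult_1_r (3 ^ length w)) at 2. apply Rmult_le_compat_l; [ lra | ].
    rewrite <- Rinv_1. apply Rinv_le_contravar; [ lra | ].
    rewrite <- sqrt_1 at 1. apply sqrt_le_1; pose proof (pos_INR k); lra.
Qed.

Lemma cps_ext a b s : (forall l, a l = b l) -> cps a s = cps b s.
Proof.
  intros E. unfold cps. f_equal; apply PSeries_ext; intros l; now rewrite E.
Qed.

(** Undoes the change of argument made by [prepend (Pole sigma)]. *)
Lemma term_untwist (sigma : C) a z w l :
  sigma <> 0 ->
  sigma ^ l * term ((a, z / sigma) :: w) l = term ((a, z) :: w) l.
Proof.
  intros Hs. destruct l; [ simpl; ring | ]. cbn [term].
  assert (E : z ^ S l = sigma ^ S l * (z / sigma) ^ S l).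
  { assert (Ez : z = sigma * (z / sigma)) by (field; auto).
    rewrite Ez at 1. apply Cpow_mult_l. }
  rewrite E. field. apply Cpow_nz, INR_S_neq_0.
Qed.

Definition untwist (sigma : C) (w : word) : word :=
  match w with nil => nil | (a, z) :: w' => (a, z / sigma) :: w' end.

Lemma term_prepend_Pole sigma w l :
  cps_derive (term (prepend (Pole sigma) w)) l = sigma ^ S l * Li_trunc (untwist sigma w) l.
Proof.
  unfold cps_derive. destruct w as [ | [a z] w ]; cbn [prepend untwist term];
    field; rewrite ?Cpow_1_r; apply INR_S_neq_0.
Qed.

(** For [Zero] this is termwise differentiation.  For [Pole sigma] the
coefficients of the derivative are the partial sums of those of [li w], weighted
by powers of [sigma], that is the product with the geometric series. *)
Lemma cder_li N x w s :
  (0 < N)%nat -> is_letter N x -> is_word N w -> (x = Zero -> w <> nil) ->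
  (0 < s < 1)%R -> cder (li (prepend x w)) s (eta x s * li w s).
Proof.
  intros HN Hx Hw Hxw Hs.
  assert (Hs' : (Rabs s < 1)%R) by (rewrite Rabs_pos_eq; lra).
  assert (Hs0 : RtoC s <> 0) by (intros E; apply RtoC_inj in E; lra).
  assert (Hb := bounded_term N w HN Hw).
  destruct (cder_cps (term (prepend x w)) s) as [Hd HL]; auto.
  { apply (bounded_term N); auto. now apply is_word_prepend. }
  replace (eta x s * li w s) with (cps (cps_derive (term (prepend x w))) s); auto.
  destruct x as [ | sigma ].
  - destruct w as [ | [a z] w ]; [ now destruct Hxw | ].
    unfold li. rewrite (cps_shift (term ((a, z) :: w))); auto.
    cbn [eta]. rewrite Cmult_assoc, Cinv_l, Cmult_1_l by auto.
    apply cps_ext. intros l. unfold cps_derive, shift. cbn [prepend term].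
    change (RtoC (INR (S l)) ^ S a) with (INR (S l) * RtoC (INR (S l)) ^ a). field. split; [ apply Cpow_nz | ]; apply INR_S_neq_0.
  - assert (Hsig : sigma <> 0) by now apply (root_of_unity_neq_0 N).
    assert (Hden : 1 - sigma * s <> 0) by (apply (one_minus_neq_0 N); auto; lra).
    set (d := cps_derive (term (prepend (Pole sigma) w))) in *.
    assert (Et : forall l, term w l = sigma ^ l * term (untwist sigma w) l).
    { intros l. destruct w as [ | [a z] w ]; cbn [untwist].
      - destruct l; simpl; ring.
      - symmetry; now apply term_untwist. }
    assert (Ed : forall l, d l = sigma ^ S l * Li_trunc (untwist sigma w) l)
      by (intros; apply term_prepend_Pole).
    (* The partial sums D and A of the two series satisfy
       (1 - sigma s) D = sigma A up to a term that tends to 0. *)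
    assert (E : forall n, sigma * sum_n (fun l => term w l * RtoC s ^ l) n =
       (1 - sigma * s) * sum_n (fun l => d l * RtoC s ^ l) n
       + sigma * s * (d n * RtoC s ^ n)).
    { induction n.
      - rewrite !sum_O, Ed, Et, Li_trunc_sum, sum_O. simpl. ring.
      - rewrite !sum_Sn. change plus with Cplus.
        rewrite Cmult_plus_distr_l, IHn, Et, !Ed, Li_trunc_S. simpl Cpow. ring. }
    assert (H0 : Clim (fun n => d n * RtoC s ^ n) 0).
    { destruct HL as [L1 L2].
      assert (M1 := is_lim_seq_ext _ _ _ (fun n => Re_sum_n _ n) L1).
      assert (M2 := is_lim_seq_ext _ _ _ (fun n => Im_sum_n _ n) L2).
      split; apply ex_series_lim_0; [ exists (Re (cps d s)) | exists (Im (cps d s)) ];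
        assumption. }
    assert (K1 := Clim_scal _ _ sigma (cps_bounded_Clim (term w) s Hb Hs')).
    assert (K2 := Clim_plus _ _ _ _ (Clim_scal _ _ (1 - sigma * s) HL)
                    (Clim_scal _ _ (sigma * s) H0)).
    assert (F := Clim_unique _ _ _ K1 (Clim_ext _ _ _ (fun n => eq_sym (E n)) K2)).
    unfold li. cbn [eta]. unfold Cdiv. rewrite (Cmult_comm sigma), <- Cmult_assoc, F. field. auto.
Qed.

Definition form := list (Z * letter).
(** Words are combined with integer coefficients: no other ones occur, because
all forms are logarithmic derivatives of rational functions. *)
Definition lin := list (Z * word).

Definition eval_form (phi : form) (s : R) : C :=
  fold_right (fun p acc => IZR (fst p) * eta (snd p) s + acc) 0 phi.

Definition eval_lin (v : lin) (s : R) : C :=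
  fold_right (fun p acc => IZR (fst p) * li (snd p) s + acc) 0 v.

Definition integrate (phi : form) (v : lin) : lin :=
  flat_map (fun p => map (fun q => ((fst p * fst q)%Z, prepend (snd p) (snd q))) v) phi.

Definition form_ok (N : nat) (phi : form) : Prop :=
  forall c x, In (c, x) phi -> is_letter N x.

Definition lin_ok (N k : nat) (v : lin) : Prop :=
  forall c w, In (c, w) v -> is_word N w /\ weight w = k.

Definition avoids (x : letter) (phi : form) : Prop := forall c, ~ In (c, x) phi.

Lemma in_integrate phi v c w :
  In (c, w) (integrate phi v) ->
  exists c1 x c2 w', In (c1, x) phi /\ In (c2, w') v /\ w = prepend x w'.
Proof.
  intros H. apply in_flat_map in H. destruct H as [[c1 x] [H1 H2]].
  apply in_map_iff in H2. destruct H2 as [[c2 w'] [E H2]].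
  injection E; intros; subst. now exists c1, x, c2, w'.
Qed.

Lemma lin_ok_integrate N k phi v :
  (0 < N)%nat -> form_ok N phi -> lin_ok N k v -> (k = O -> avoids Zero phi) ->
  lin_ok N (S k) (integrate phi v).
Proof.
  intros HN Hphi Hv H0 c w Hin.
  destruct (in_integrate _ _ _ _ Hin) as (c1 & x & c2 & w' & H1 & H2 & ->).
  destruct (Hv _ _ H2) as [Hw Ek]. split.
  - apply is_word_prepend; auto. now apply (Hphi c1).
  - rewrite weight_prepend, Ek; auto.
    intros -> ->. apply (H0 (eq_sym Ek) c1 H1).
Qed.

Lemma eval_lin_app u v s : eval_lin (u ++ v) s = eval_lin u s + eval_lin v s.
Proof. induction u; simpl; [ ring | rewrite IHu; ring ]. Qed.

Lemma eval_form_app u v s : eval_form (u ++ v) s = eval_form u s + eval_form v s.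
Proof. induction u; simpl; [ ring | rewrite IHu; ring ]. Qed.

Lemma cder_integrate N k phi v s :
  (0 < N)%nat -> form_ok N phi -> lin_ok N k v -> (k = O -> avoids Zero phi) ->
  (0 < s < 1)%R ->
  cder (eval_lin (integrate phi v)) s (eval_form phi s * eval_lin v s).
Proof.
  intros HN Hphi Hv H0 Hs. induction phi as [ | [c x] phi IH ].
  - simpl. replace (0 * eval_lin v s) with (RtoC 0) by ring. apply cder_const.
  - cbn [integrate flat_map]. fold (integrate phi v).
    eapply cder_ext; [ intros y; symmetry; apply eval_lin_app | ].
    replace (eval_form ((c, x) :: phi) s * eval_lin v s)
      with (IZR c * eta x s * eval_lin v s + eval_form phi s * eval_lin v s) by (simpl; ring).
    apply cder_plus.
    2:{ apply IH; [ intros d y Hy; apply (Hphi d); now right | ].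
        intros E d Hd. apply (H0 E d). now right. }
    assert (Hx : is_letter N x) by (apply (Hphi c); now left).
    assert (H0' : k = O -> x <> Zero) by (intros E ->; apply (H0 E c); now left).
    clear IH Hphi H0. induction v as [ | [d w] v IH ].
    + simpl. replace (IZR c * eta x s * 0) with (RtoC 0) by ring. apply cder_const.
    + change (eval_lin ((d, w) :: v) s) with (IZR d * li w s + eval_lin v s).
      replace (IZR c * eta x s * (IZR d * li w s + eval_lin v s))
        with (IZR (c * d) * (eta x s * li w s) + IZR c * eta x s * eval_lin v s)
        by (rewrite mult_IZR, RtoC_mult; ring).
      change (cder (fun y => IZR (c * d) * li (prepend x w) y
        + eval_lin (map (fun q => ((c * fst q)%Z, prepend x (snd q))) v) y) s
        (IZR (c * d) * (eta x s * li w s) + IZR c * eta x s * eval_lin v s)).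
      apply cder_plus.
      * apply cder_scal. destruct (Hv d w) as [Hw Ek]; [ now left | ].
        apply (cder_li N); auto. intros -> ->. now apply (H0' (eq_sym Ek)).
      * apply IH. intros d' w' H'. apply (Hv d'). now right.
Qed.

(** Vanishing at 0 and at most a simple pole at 1: crude at 1, where the growth is
logarithmic, but enough against the double zero of [X] there. *)
Lemma eval_lin_bound N k v :
  (0 < N)%nat -> lin_ok N (S k) v ->
  exists B, (0 <= B)%R /\
  forall s : R, (0 <= s < 1)%R -> (Cmod (eval_lin v s) <= B * (s * / (1 - s)))%R.
Proof.
  intros HN Hv. induction v as [ | [c w] v IH ].
  - exists 0%R. split; [ lra | ]. intros s _. simpl. rewrite Cmod_0. lra.
  - destruct IH as [B [HB IH]]; [ intros d u Hu; apply (Hv d); now right | ].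
    destruct (Hv c w) as [Hw Ek]; [ now left | ].
    assert (Hb := bounded_term N w HN Hw).
    destruct (Cmod_cps _ (bounded_shift _ Hb)) as [B' HB'].
    assert (HB0 : (0 <= B')%R).
    { specialize (HB' 0%R ltac:(lra)). pose proof (Cmod_ge_0 (cps (shift (term w)) 0)).
      rewrite Rminus_0_r, Rinv_1 in HB'. lra. }
    exists (Rabs (IZR c) * B' + B)%R. split.
    { pose proof (Rabs_pos (IZR c)). nra. }
    intros s Hs. cbn [eval_lin fold_right fst snd].
    eapply Rle_trans; [ apply Cmod_triangle | ].
    specialize (IH s Hs). fold (eval_lin v s).
    assert (Cmod (IZR c * li w s)%C <= Rabs (IZR c) * (s * (B' * / (1 - s))))%R.
    { unfold li. rewrite cps_shift; auto.
      - rewrite !Cmod_mult, !Cmod_R, (Rabs_pos_eq s) by lra.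
        apply Rmult_le_compat_l; [ apply Rabs_pos | ].
        apply Rmult_le_compat_l; [ lra | ]. now apply HB'.
      - rewrite Rabs_pos_eq; lra.
      - destruct w as [ | [a z] w ]; [ discriminate | reflexivity ]. }
    lra.
Qed.

Lemma eval_form_bound N phi :
  (0 < N)%nat -> form_ok N phi ->
  exists M, (0 <= M)%R /\
  forall s : R, (0 < s < 1)%R -> (Cmod (eval_form phi s) <= M * / (s * (1 - s)))%R.
Proof.
  intros HN Hphi. induction phi as [ | [c x] phi IH ].
  - exists 0%R. split; [ lra | ]. intros s _. simpl. rewrite Cmod_0. lra.
  - destruct IH as [M [HM IH]]; [ intros d u Hu; apply (Hphi d); now right | ].
    exists (Rabs (IZR c) + M)%R. split.
    { pose proof (Rabs_pos (IZR c)). lra. }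
    intros s Hs. cbn [eval_form fold_right fst snd].
    eapply Rle_trans; [ apply Cmod_triangle | ].
    specialize (IH s Hs). fold (eval_form phi s).
    assert (Cmod (IZR c * eta x s)%C <= Rabs (IZR c) * / (s * (1 - s)))%R; [ | lra ].
    rewrite Cmod_mult, Cmod_R. apply Rmult_le_compat_l; [ apply Rabs_pos | ].
    assert (Hx : is_letter N x) by (apply (Hphi c); now left).
    destruct x as [ | sigma ]; cbn [eta].
    + rewrite Cmod_inv, Cmod_R, Rabs_pos_eq by (try lra; intros E; apply RtoC_inj in E; lra).
      apply Rinv_le_contravar; nra.
    + assert (Hm := Cmod_root_of_unity N sigma HN Hx).
      assert (Hd : (1 - s <= Cmod (1 - sigma * s)%C)%R).
      { assert (T := Cmod_triangle (1 - sigma * s) (sigma * s)).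
        replace (1 - sigma * s + sigma * s) with (RtoC 1) in T by ring.
        rewrite Cmod_1, (Cmod_mult sigma), Hm, Cmod_R, Rabs_pos_eq in T; lra. }
      rewrite Cmod_div, Hm.
      2:{ intros E. rewrite E, Cmod_0 in Hd. lra. }
      unfold Rdiv. rewrite Rmult_1_l. apply Rinv_le_contravar; nra.
Qed.

(** The letter prepended last decides: [Zero] raises the outermost exponent to at
least 2, and [Pole sigma] puts [sigma <> 1] in front. *)
Lemma admissible_integrate N k phi v c w :
  form_ok N phi -> avoids (Pole 1) phi -> lin_ok N (S k) v ->
  In (c, w) (integrate phi v) -> admissible w.
Proof.
  intros Hphi H1 Hv Hin.
  destruct (in_integrate _ _ _ _ Hin) as (c1 & x & c2 & w' & Hx & Hw & ->).
  destruct (Hv _ _ Hw) as [Hw' Ek].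
  destruct w' as [ | [a z] w' ]; [ discriminate | ].
  apply is_word_cons in Hw'. destruct Hw' as [[Ha _] _].
  destruct x as [ | sigma ]; simpl; intros E; injection E; intros; subst; [ lia | ].
  now apply (H1 c1).
Qed.

Definition conj_word (w : word) : word := map (fun p => (fst p, Cconj (snd p))) w.

Lemma Cconj_RtoC x : Cconj (RtoC x) = x.
Proof. unfold Cconj, RtoC. cbn [fst snd]. f_equal. ring. Qed.

Lemma Li_trunc_conj w L : Li_trunc (conj_word w) L = Cconj (Li_trunc w L).
Proof.
  revert L. induction w as [ | [a z] w IH ]; intros L.
  - simpl. now rewrite Cconj_RtoC.
  - induction L.
    + rewrite !Li_trunc_sum, !sum_O. simpl. now rewrite Cconj_RtoC.
    + rewrite !(Li_trunc_S _ L), IHL, Cplus_conj. f_equal.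
      cbn [conj_word map fst snd term]. fold (conj_word w).
      rewrite IH, Cmult_conj, Cdiv_conj, !Cpow_conj, Cconj_RtoC
        by apply Cpow_nz, INR_S_neq_0.
      reflexivity.
Qed.

Lemma is_word_conj N w : is_word N w -> is_word N (conj_word w).
Proof.
  intros H a z Hin. apply in_map_iff in Hin. destruct Hin as [[b y] [E Hb]].
  injection E; intros; subst. destruct (H _ _ Hb) as [Hp Hy]. split; auto.
  rewrite <- Cpow_conj, Hy. apply Cconj_RtoC.
Qed.

Lemma weight_conj w : weight (conj_word w) = weight w.
Proof. unfold weight, conj_word. now rewrite map_map. Qed.

Lemma admissible_conj w : admissible w -> admissible (conj_word w).
Proof.
  destruct w as [ | [a z] w ]; simpl; auto. intros H E. apply H.
  assert (E1 := f_equal fst E). assert (E2 := f_equal snd E). cbn [fst snd] in E1, E2.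
  rewrite <- (Cconj_conj z), E1, E2. f_equal. apply Cconj_RtoC.
Qed.

(** Only the real part is followed, since the sum of the series is [- 2 Re V]; the
conjugate values it brings in have the same level and weight. *)
Lemma eval_lin_limit N k v :
  (0 < N)%nat -> lin_ok N k v -> (forall c w, In (c, w) v -> admissible w) ->
  exists V : R,
    filterlim (fun s => Re (eval_lin v s)) (at_left 1) (locally V) /\
    CMZV k N (RtoC (-2 * V)).
Proof.
  intros HN Hv Ha. induction v as [ | [c w] v IH ].
  - exists 0%R. split; [ exact (filterlim_const (U := R_UniformSpace) (F := at_left 1) 0%R) | ]. rewrite Rmult_0_r. apply Q_span_0.
  - destruct IH as [V [HV HC]].
    { intros d u Hu; apply (Hv d); now right. }
    { intros d u Hu; apply (Ha d); now right. }
    destruct (Hv c w) as [Hw Ek]; [ now left | ].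
    assert (Hadm : admissible w) by (apply (Ha c); now left).
    destruct (admissible_Li_converges N w HN Hw Hadm) as [l Hl].
    exists (IZR c * Re l + V)%R. split.
    + cbn [eval_lin fold_right fst snd].
      apply (filterlim_ext (fun s => (IZR c * Re (li w s) + Re (eval_lin v s))%R)).
      { intros s. rewrite re_plus, re_scal_l. reflexivity. }
      apply (filterlim_comp_2 (G := locally (IZR c * Re l)%R) (H := locally V)).
      * apply (filterlim_comp _ _ _ (fun s => Re (li w s)) (fun x => (IZR c * x)%R) _ (locally (Re l))).
        -- cbn [li cps Re fst]. apply Abel_limit. destruct Hl as [Hl _].
           eapply is_lim_seq_ext; [ | exact Hl ]. intros n. cbv beta.
           rewrite Li_trunc_sum. apply Re_sum_n.
        -- apply (filterlim_scal_r (K := R_AbsRing) (V := R_NormedModule) (IZR c) (Re l)).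
      * exact HV.
      * apply (filterlim_plus (V := R_NormedModule) (IZR c * Re l)%R V).
    + (* -2 c Re l = - c l - c (conj l) *)
      replace (RtoC (-2 * (IZR c * Re l + V)))
        with (Q2R (inject_Z (- c)) * l + (Q2R (inject_Z (- c)) * Cconj l + RtoC (-2 * V))).
      2:{ unfold Q2R, inject_Z. simpl. rewrite opp_IZR, Rinv_1, Rmult_1_r.
          destruct l as [x y]. unfold Cconj, RtoC, Cmult, Cplus, Re; simpl. f_equal; ring. }
      apply Q_span_add; [ | apply Q_span_add; auto ].
      * exists w. split; [ auto | split; [ exact Hw | split; [ auto | ] ] ].
        now apply Clim_filterlim.
      * exists (conj_word w).
        split; [ now apply admissible_conj | split; [ now apply is_word_conj | ] ].
        split; [ now rewrite weight_conj | ].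
        apply Clim_filterlim. destruct Hl as [L1 L2].
        split.
        -- eapply is_lim_seq_ext; [ | exact L1 ]. intros n. now rewrite Li_trunc_conj.
        -- rewrite im_conj. apply is_lim_seq_opp in L2.
              eapply is_lim_seq_ext; [ | exact L2 ]. intros n. now rewrite Li_trunc_conj.
Qed.

(** * Central binomial coefficients as beta integrals *)

(** The integral of [(u (1 - u))^n] for [u] from 0 to [t], in the form given by
integration by parts.  The recursion is used instead of the integral because it
makes the value on the line [Re t = 1/2] immediate. *)
Fixpoint beta_poly (n : nat) (t : C) : C :=
  match n with
  | O => t
  | S m => (INR (S m) * beta_poly m t - (t * (1 - t)) ^ S m * (1 - 2 * t))
           / INR (4 * S m + 2)
  end.

Lemma cder_beta_poly (t : R -> C) s l n :
  cder t s l ->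
  cder (fun x => beta_poly n (t x)) s ((t s * (1 - t s)) ^ n * l).
Proof.
  intros Ht. induction n.
  - replace ((t s * (1 - t s)) ^ 0 * l) with l by (simpl; ring). exact Ht.
  - assert (H1 : cder (fun x => 1 - t x) s (0 - l)) by (apply cder_minus; auto; apply cder_const).
    assert (H2 : cder (fun x => 1 - 2 * t x) s (0 - 2 * l)).
    { apply cder_minus; [ apply cder_const | now apply cder_scal ]. }
    assert (Hy := cder_pow _ s _ n (cder_mult _ _ _ _ _ Ht H1)). cbv beta in Hy.
    assert (H := cder_scal (/ INR (4 * S n + 2)) _ s _
      (cder_minus _ _ s _ _ (cder_scal (INR (S n)) _ s _ IHn) (cder_mult _ _ s _ _ Hy H2))).
    cbv beta in H.
    set (y := t s * (1 - t s)) in *.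
    assert (Hd : RtoC (INR (4 * S n + 2)) <> 0).
    { intros E. apply RtoC_inj in E. revert E. apply not_0_INR. lia. }
    assert (Ed : RtoC (INR (4 * S n + 2)) = 4 * INR (S n) + 2).
    { rewrite plus_INR, mult_INR, RtoC_plus, RtoC_mult. simpl (INR 4). simpl (INR 2).
      f_equal; f_equal; f_equal; ring. }
    match type of H with cder _ _ ?v => replace v with (y ^ S n * l) in H end.
    { eapply cder_ext; [ | exact H ]. intros x. cbn [beta_poly]. unfold Cdiv. apply Cmult_comm. }
    replace (y ^ S n * l)
      with (/ INR (4 * S n + 2) * (INR (4 * S n + 2) * (y ^ S n * l))) by (field; auto).
    f_equal. rewrite Ed. simpl Cpow. unfold y. ring.
Qed.

Lemma beta_poly_0 n : beta_poly n 0 = 0.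
Proof.
  induction n; [ reflexivity | ]. cbn [beta_poly]. rewrite IHn. simpl Cpow.
  unfold Cdiv. ring.
Qed.

Lemma central_binomial_step n :
  (INR (S n) * Binomial.C (2 * S n) (S n) = INR (4 * n + 2) * Binomial.C (2 * n) n)%R.
Proof.
  unfold Binomial.C.
  replace (2 * S n - S n)%nat with (S n) by lia. replace (2 * n - n)%nat with n by lia.
  replace (2 * S n)%nat with (S (S (2 * n))) by lia.
  rewrite !fact_simpl, !mult_INR. rewrite (S_INR (S (2 * n))), (S_INR (2 * n)), (S_INR n), !mult_INR.
  rewrite plus_INR, mult_INR. simpl (INR 2). simpl (INR 4).
  pose proof (INR_fact_neq_0 n). pose proof (pos_INR n). field. split; lra.
Qed.

Lemma Binomial_C_pos n k : (0 < Binomial.C n k)%R.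
Proof.
  unfold Binomial.C. apply Rdiv_lt_0_compat; [ apply INR_fact_lt_0 | ].
  apply Rmult_lt_0_compat; apply INR_fact_lt_0.
Qed.

(** On the line [Re t = 1/2] the boundary term of the recursion is purely
imaginary, so the real parts satisfy the recursion of the central binomial
coefficients. *)
Lemma Re_beta_poly n t :
  Re (1 - 2 * t) = 0%R -> Im (t * (1 - t)) = 0%R ->
  Re (beta_poly n t) = (/ (INR (S n) * Binomial.C (2 * S n) (S n)))%R.
Proof.
  intros H1 H2. induction n.
  - unfold Re, Im in *. simpl in *. unfold Binomial.C. simpl. lra.
  - assert (E : t * (1 - t) = RtoC (Re (t * (1 - t)))).
    { destruct (t * (1 - t)) as [x y]; unfold RtoC, Re, Im in *; simpl in *. now rewrite H2. }
    assert (HP := Binomial_C_pos (2 * S n) (S n)).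
    assert (HS : (0 < INR (S n))%R) by (apply lt_0_INR; lia).
    assert (H4 : (0 < INR (4 * S n + 2))%R) by (apply lt_0_INR; lia).
    rewrite (central_binomial_step (S n)).
    cbn [beta_poly]. unfold Cdiv. rewrite <- RtoC_inv by lra.
    rewrite re_scal_r. unfold Cminus at 1. rewrite re_plus, re_scal_l, IHn.
    rewrite E, <- RtoC_pow.
    replace (Re (- (RtoC (Re (t * (1 - t)) ^ S n) * (1 - 2 * t)))) with
      (- (Re (t * (1 - t)) ^ S n * Re (1 - 2 * t)))%R
      by (unfold Re; simpl; ring).
    rewrite H1. field. lra.
Qed.

(** * Growth of the harmonic numbers *)

Lemma harmonic_0 : harmonic 0 = 0.
Proof. unfold harmonic, Csum. rewrite sum_n_m_zero; [ reflexivity | lia ]. Qed.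

Lemma harmonic_S k : harmonic (S k) = harmonic k + / INR (S k).
Proof.
  unfold harmonic, Csum. rewrite sum_n_Sm by lia. change plus with Cplus.
  f_equal. unfold Cdiv. apply Cmult_1_l.
Qed.

Lemma harmonic_real k : harmonic k = RtoC (Re (harmonic k)).
Proof.
  induction k; [ now rewrite harmonic_0 | ].
  rewrite harmonic_S, IHk at 1. rewrite harmonic_S, re_plus.
  rewrite <- RtoC_inv by (apply not_0_INR; lia). rewrite re_RtoC, RtoC_plus. reflexivity.
Qed.

Lemma Cmod_harmonic k : (Cmod (harmonic (S k)) <= 1 + ln (INR (S k)))%R.
Proof.
  induction k.
  - rewrite harmonic_S, harmonic_0. simpl INR. rewrite ln_1.
    rewrite <- RtoC_inv, <- RtoC_plus, Cmod_R, Rabs_pos_eq by lra. lra.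
  - rewrite harmonic_S. eapply Rle_trans; [ apply Cmod_triangle | ].
    rewrite <- RtoC_inv by (apply not_0_INR; lia).
    assert (H1 : (0 < INR (S k))%R) by (apply lt_0_INR; lia).
    rewrite (S_INR (S k)) in *. set (x := INR (S k)) in *.
    rewrite Cmod_R, Rabs_pos_eq by (left; apply Rinv_0_lt_compat; lra).
    (* ln x - ln (x + 1) = ln (1 - 1/(x+1)) <= - 1/(x+1) *)
    assert (E : (ln x = ln (x + 1) + ln (x / (x + 1)))%R).
    { rewrite <- ln_mult; [ f_equal; field; lra | lra | apply Rdiv_lt_0_compat; lra ]. }
    assert (L : (ln (x / (x + 1)) <= - / (x + 1))%R).
    { replace (- / (x + 1))%R with (x / (x + 1) - 1)%R by (field; lra).
      set (w := (x / (x + 1))%R). assert (Hw : (0 < w)%R) by (apply Rdiv_lt_0_compat; lra).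
      pose proof (exp_ineq1_le (ln w)). rewrite exp_ln in H; lra. }
    lra.
Qed.

(** [ln x = 4 ln (x^(1/4))] is at most [4 x^(1/4)]. *)
Lemma harmonic_over_sqrt A :
  is_lim_seq (fun k => A * (Cmod (harmonic (S k)) + 1) * / sqrt (INR (S k)))%R 0%R.
Proof.
  assert (H : is_lim_seq (fun k => (Cmod (harmonic (S k)) + 1) * / sqrt (INR (S k)))%R 0%R).
  { apply is_lim_seq_0_dominated with (fun k => 6 * / sqrt (sqrt (INR k + 1)))%R.
    - intros k. rewrite <- S_INR.
      assert (H1 : (1 <= INR (S k))%R) by (rewrite S_INR; pose proof (pos_INR k); lra).
      assert (Hx : (1 <= sqrt (INR (S k)))%R) by (rewrite <- sqrt_1; apply sqrt_le_1; lra).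
      assert (Hy : (1 <= sqrt (sqrt (INR (S k))))%R) by (rewrite <- sqrt_1 at 1; apply sqrt_le_1; lra).
      assert (E1 := sqrt_sqrt (INR (S k)) ltac:(lra)).
      assert (E2 := sqrt_sqrt (sqrt (INR (S k))) ltac:(lra)).
      assert (HH := Cmod_harmonic k). pose proof (Cmod_ge_0 (harmonic (S k))).
      set (y := sqrt (sqrt (INR (S k)))) in *. rewrite <- E2 in *.
      assert (EL : (ln (INR (S k)) = 4 * ln y)%R).
      { rewrite <- E1. rewrite !ln_mult by nra. ring. }
      assert (L : (ln y <= y - 1)%R) by (pose proof (exp_ineq1_le (ln y)); rewrite exp_ln in *; lra).
      rewrite Rabs_pos_eq.
      2:{ apply Rmult_le_pos; [ lra | left; apply Rinv_0_lt_compat; nra ]. }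
      replace (6 * / y)%R with ((6 * y) * / (y * y))%R by (field; lra).
      apply Rmult_le_compat_r; [ left; apply Rinv_0_lt_compat; nra | lra ].
    - replace (Finite 0%R) with (Rbar_mult 6%R 0%R) by (simpl; f_equal; ring).
      apply is_lim_seq_scal_l.
      apply is_lim_seq_spec. intros eps. pose proof (cond_pos eps) as He.
      destruct (proj2 (is_lim_seq_spec _ _) is_lim_seq_inv_sqrt (mkposreal (eps * eps) ltac:(nra)))
        as [n Hn].
      exists n. intros k Hk. specialize (Hn k Hk). simpl in Hn.
      pose proof (pos_INR k).
      assert (Hx : (0 < sqrt (INR k + 1))%R) by (apply sqrt_lt_R0; lra).
      assert (Hy : (0 < sqrt (sqrt (INR k + 1)))%R) by now apply sqrt_lt_R0.
      assert (E2 := sqrt_sqrt (sqrt (INR k + 1)) ltac:(lra)).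
      rewrite <- E2 in Hn. set (y := sqrt (sqrt (INR k + 1))) in *.
      assert (Hi : (0 < / y)%R) by now apply Rinv_0_lt_compat.
      rewrite Rminus_0_r, Rabs_pos_eq in * by (rewrite ?Rinv_mult; nra).
      rewrite Rinv_mult in Hn. nra. }
  replace (Finite 0%R) with (Rbar_mult A 0%R) by (simpl; f_equal; ring).
  apply (is_lim_seq_scal_l _ A) in H.
  eapply is_lim_seq_ext; [ | exact H ]. intros k. simpl. ring.
Qed.

(** * Truncated generating functions *)

(** Truncations, at [k <= K], of [sum H_k x^k / k^m]. *)
Fixpoint hpoly (m K : nat) (x : C) : C :=
  match K with
  | O => 0
  | S K' => hpoly m K' x + harmonic (S K') / INR (S K') ^ m * x ^ S K'
  end.

Fixpoint lpoly (K : nat) (x : C) : C :=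
  match K with O => 0 | S K' => lpoly K' x + / INR (S K') * x ^ S K' end.

Fixpoint gpoly (K : nat) (x : C) : C :=
  match K with O => 0 | S K' => gpoly K' x + x ^ S K' end.

Lemma gpoly_closed K x : gpoly K x * (1 - x) = x - x ^ S K.
Proof. induction K; simpl in *; [ ring | rewrite Cmult_plus_distr_r, IHK; ring ]. Qed.

(** The truncated form of [sum H_k x^k = - log (1 - x) / (1 - x)]; its last term
is the source of the error in [cder_primitive]. *)
Lemma hpoly_0_closed K x :
  hpoly 0 K x * (1 - x) = lpoly K x - harmonic K * x ^ S K.
Proof.
  induction K.
  - simpl. rewrite harmonic_0. ring.
  - cbn [hpoly lpoly]. rewrite Cmult_plus_distr_r, IHK, harmonic_S. simpl Cpow. field.
    apply INR_S_neq_0.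
Qed.

Lemma cder_hpoly m K X s xi :
  cder X s (xi * X s) ->
  cder (fun u => hpoly (S m) K (X u)) s (hpoly m K (X s) * xi).
Proof.
  intros HX. induction K.
  - simpl. rewrite Cmult_0_l. apply cder_const.
  - cbn [hpoly]. rewrite Cmult_plus_distr_r. apply cder_plus; auto.
    replace (harmonic (S K) / INR (S K) ^ m * X s ^ S K * xi) with
      (harmonic (S K) / INR (S K) ^ S m * (INR (S K) * X s ^ K * (xi * X s))).
    { apply cder_scal. now apply cder_pow. }
    change (RtoC (INR (S K)) ^ S m) with (INR (S K) * RtoC (INR (S K)) ^ m).
    change (X s ^ S K) with (X s * X s ^ K).
    field. split; [ apply Cpow_nz | ]; apply INR_S_neq_0.
Qed.

Lemma cder_lpoly K X s xi :
  cder X s (xi * X s) ->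
  cder (fun u => lpoly K (X u)) s (gpoly K (X s) * xi).
Proof.
  intros HX. induction K.
  - simpl. rewrite Cmult_0_l. apply cder_const.
  - cbn [lpoly gpoly]. rewrite Cmult_plus_distr_r. apply cder_plus; auto.
    replace (X s ^ S K * xi) with
      (/ INR (S K) * (INR (S K) * X s ^ K * (xi * X s))).
    { apply cder_scal. now apply cder_pow. }
    change (X s ^ S K) with (X s * X s ^ K).
    field. apply INR_S_neq_0.
Qed.

Lemma Cmod_pow_le x k : (Cmod x <= 1)%R -> (Cmod (x ^ S k) <= Cmod x)%R.
Proof.
  intros H. rewrite Cmod_pow. simpl. pose proof (Cmod_ge_0 x).
  assert (Cmod x ^ k <= 1)%R by (rewrite <- (pow1 k); apply pow_incr; lra). nra.
Qed.

Lemma hpoly_bound m K :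
  exists A, (0 <= A)%R /\ forall x, (Cmod x <= 1)%R -> (Cmod (hpoly m K x) <= A * Cmod x)%R.
Proof.
  induction K.
  - exists 0%R. split; [ lra | ]. intros. simpl. rewrite Cmod_0. lra.
  - destruct IHK as [A [HA IH]].
    set (c := harmonic (S K) / INR (S K) ^ m).
    exists (A + Cmod c)%R. split; [ pose proof (Cmod_ge_0 c); lra | ].
    intros x Hx. cbn [hpoly]. eapply Rle_trans; [ apply Cmod_triangle | ].
    fold c. rewrite Cmod_mult. specialize (IH x Hx). assert (P := Cmod_pow_le x K Hx).
    pose proof (Cmod_ge_0 c). nra.
Qed.

Lemma lpoly_bound K :
  exists A, (0 <= A)%R /\ forall x, (Cmod x <= 1)%R -> (Cmod (lpoly K x) <= A * Cmod x)%R.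
Proof.
  induction K.
  - exists 0%R. split; [ lra | ]. intros. simpl. rewrite Cmod_0. lra.
  - destruct IHK as [A [HA IH]].
    set (c := / INR (S K)).
    exists (A + Cmod c)%R. split; [ pose proof (Cmod_ge_0 c); lra | ].
    intros x Hx. cbn [lpoly]. eapply Rle_trans; [ apply Cmod_triangle | ].
    fold c. rewrite Cmod_mult. specialize (IH x Hx). assert (P := Cmod_pow_le x K Hx).
    pose proof (Cmod_ge_0 c). nra.
Qed.

Lemma li_nil s : (Rabs s < 1)%R -> li nil s = 1.
Proof.
  intros Hs. assert (Hb : Cbounded (term nil)).
  { exists 1%R. intros [ | l ]; simpl; rewrite ?Cmod_1, ?Cmod_0; lra. }
  apply Clim_unique with (1 := cps_bounded_Clim (term nil) s Hb Hs).
  eapply Clim_ext; [ | apply Clim_const ]. intros n.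
  induction n; [ rewrite sum_O | rewrite sum_Sn, <- IHn; change plus with Cplus ];
    simpl; eqC; ring.
Qed.

(** * Parametrized paths and the series attached to them *)

(** A path [t] from the line [Re t = 1/2] to 0, together with the pull-backs
[g = dlog (t / (1 - t))], [a = - dlog X] and [b = dlog (1 - X)], where
[X = z (t (1 - t))^2].  The signs are those that the integration by parts
produces, so that the words below need none. *)
Record parametrization (N : nat) (z : R) (t : R -> C) (g a b : form) : Prop := {
  level_pos : (0 < N)%nat;
  g_level : form_ok N g;
  a_level : form_ok N a;
  b_level : form_ok N b;
  g_regular : avoids Zero g;
  b_regular : avoids (Pole 1) b;
  t_smooth : forall s, (0 <= s <= 1)%R -> exists l, cder t s l;
  t_deriv : forall s, (0 < s < 1)%R -> cder t s (eval_form g s * (t s * (1 - t s)));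
  a_eq : forall s, (0 < s < 1)%R -> eval_form a s = - (2 * eval_form g s * (1 - 2 * t s));
  b_eq : forall s, (0 < s < 1)%R ->
    eval_form b s * (1 - z * (t s * (1 - t s)) ^ 2) = eval_form a s * (z * (t s * (1 - t s)) ^ 2);
  decay : forall s, (0 <= s <= 1)%R ->
    (Cmod (z * (t s * (1 - t s)) ^ 2)%C <= ((1 - s ^ 2) / (1 + s ^ 2)) ^ 2)%R;
  t_start : Re (1 - 2 * t 0) = 0%R;
  y_start : Im (t 0%R * (1 - t 0%R)) = 0%R;
  t_end : t 1%R = 0
}.

Arguments level_pos {N z t g a b}.
Arguments g_level {N z t g a b}.
Arguments a_level {N z t g a b}.
Arguments b_level {N z t g a b}.
Arguments g_regular {N z t g a b}.
Arguments b_regular {N z t g a b}.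
Arguments t_smooth {N z t g a b}.
Arguments t_deriv {N z t g a b}.
Arguments a_eq {N z t g a b}.
Arguments b_eq {N z t g a b}.
Arguments decay {N z t g a b}.
Arguments t_start {N z t g a b}.
Arguments y_start {N z t g a b}.
Arguments t_end {N z t g a b}.

(** The words met when the integrations are moved off the sum over [k]: [g] once,
[a] for each division by [k] but the last, [a + b] for the last division together
with the factor [1 / (1 - X)], and [b] for the remaining logarithm. *)
Definition unit_lin : lin := (1%Z, nil) :: nil.

Fixpoint inner (g a : form) (j : nat) : lin :=
  match j with O => integrate g unit_lin | S i => integrate a (inner g a i) end.

Definition penultimate (g a b : form) (n : nat) : lin := integrate (a ++ b) (inner g a n).

Definition final (g a b : form) (n : nat) : lin := integrate b (penultimate g a b n).

Definition Xof (z : R) (t : R -> C) (s : R) : C := z * (t s * (1 - t s)) ^ 2.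

(** The boundary terms of the first [m + 1] integrations by parts. *)
Fixpoint ladder (g a : form) (R0 K : nat) (X : R -> C) (m : nat) (s : R) : C :=
  match m with
  | O => hpoly R0 K (X s) * eval_lin (inner g a 0) s
  | S i => ladder g a R0 K X i s + hpoly (R0 - S i) K (X s) * eval_lin (inner g a (S i)) s
  end.

(** A primitive, up to [error], of [sum (H_k / k^(n+1)) X^k g].  Its last term
alone survives at [s = 1], and all of it vanishes at [s = 0]. *)
Definition primitive (g a b : form) (n K : nat) (X : R -> C) (s : R) : C :=
  ladder g a (S n) K X n s + lpoly K (X s) * eval_lin (penultimate g a b n) s
  + eval_lin (final g a b n) s.

(** The integral of the same truncated sum, computed term by term from [t = 0]. *)
Fixpoint psum (z : R) (r K : nat) (tau : C) : C :=
  match K with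
  | O => 0
  | S k => psum z r k tau
           + harmonic (S k) / INR (S k) ^ r * RtoC z ^ S k * beta_poly (S (2 * k)) tau
  end.

Lemma form_ok_app N u v : form_ok N u -> form_ok N v -> form_ok N (u ++ v).
Proof. intros Hu Hv c x H. apply in_app_or in H. destruct H; [ apply (Hu c) | apply (Hv c) ]; auto. Qed.

Lemma lin_ok_unit N : lin_ok N 0 unit_lin.
Proof. intros c w [E | []]. injection E; intros; subst. split; [ intros ? ? [] | reflexivity ]. Qed.

Section SeriesAlongPath.
Context (N : nat) (z : R) (t : R -> C) (g a b : form) (P : parametrization N z t g a b).

Lemma inner_ok j : lin_ok N (S j) (inner g a j).
Proof.
  pose proof (level_pos P). pose proof (g_level P).
  pose proof (a_level P). pose proof (g_regular P).
  induction j; cbn [inner]; apply lin_ok_integrate; auto.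
  - apply lin_ok_unit.
  - discriminate.
Qed.

Lemma penultimate_ok n : lin_ok N (S (S n)) (penultimate g a b n).
Proof.
  apply lin_ok_integrate; [ apply (level_pos P) | | apply inner_ok | discriminate ].
  apply form_ok_app; [ apply (a_level P) | apply (b_level P) ].
Qed.

Lemma final_ok n : lin_ok N (S (S (S n))) (final g a b n).
Proof.
  apply lin_ok_integrate;
    [ apply (level_pos P) | apply (b_level P)
    | apply penultimate_ok | discriminate ].
Qed.

Lemma cder_inner_0 s :
  (0 < s < 1)%R -> cder (eval_lin (inner g a 0)) s (eval_form g s).
Proof.
  intros Hs. replace (eval_form g s) with (eval_form g s * eval_lin unit_lin s).
  - apply (cder_integrate N 0); auto.
    + apply (level_pos P).
    + apply (g_level P).
    + apply lin_ok_unit.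
    + intros _; apply (g_regular P).
  - simpl. rewrite li_nil by (rewrite Rabs_pos_eq; lra). ring.
Qed.

Lemma cder_inner_S j s :
  (0 < s < 1)%R ->
  cder (eval_lin (inner g a (S j))) s (eval_form a s * eval_lin (inner g a j) s).
Proof.
  intros Hs. apply (cder_integrate N (S j)); auto.
  - apply (level_pos P).
  - apply (a_level P).
  - apply inner_ok.
  - discriminate.
Qed.

Lemma cder_penultimate n s :
  (0 < s < 1)%R ->
  cder (eval_lin (penultimate g a b n)) s
    ((eval_form a s + eval_form b s) * eval_lin (inner g a n) s).
Proof.
  intros Hs. rewrite <- eval_form_app. apply (cder_integrate N (S n)); auto.
  - apply (level_pos P).
  - apply form_ok_app; [ apply (a_level P) | apply (b_level P) ].
  - apply inner_ok.
  - discriminate.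
Qed.

Lemma cder_final n s :
  (0 < s < 1)%R ->
  cder (eval_lin (final g a b n)) s (eval_form b s * eval_lin (penultimate g a b n) s).
Proof.
  intros Hs. apply (cder_integrate N (S (S n))); auto.
  - apply (level_pos P).
  - apply (b_level P).
  - apply penultimate_ok.
  - discriminate.
Qed.

Lemma cder_X s :
  (0 < s < 1)%R -> cder (Xof z t) s (- eval_form a s * Xof z t s).
Proof.
  intros Hs. assert (Ht := t_deriv P s Hs).
  assert (H1 : cder (fun x => 1 - t x) s (0 - eval_form g s * (t s * (1 - t s))))
    by (apply cder_minus; auto; apply cder_const).
  assert (H := cder_scal z _ s _ (cder_pow _ s _ 1 (cder_mult _ _ _ _ _ Ht H1))).
  cbv beta in H. unfold Xof. rewrite (a_eq P s Hs).
  match type of H with cder _ _ ?v => replace v with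
    (- - (2 * eval_form g s * (1 - 2 * t s)) * (z * (t s * (1 - t s)) ^ 2)) in H; auto end.
  simpl Cpow. replace (RtoC (INR 2)) with (RtoC 2) by (simpl; f_equal; ring). ring.
Qed.

(** The derivatives of consecutive terms cancel: lowering the exponent of [hpoly]
brings the factor [- a], lengthening the word brings [a]. *)
Lemma cder_ladder R0 K m s :
  (m < R0)%nat -> (0 < s < 1)%R ->
  cder (ladder g a R0 K (Xof z t) m) s
    (hpoly R0 K (Xof z t s) * eval_form g s
     - hpoly (R0 - S m) K (Xof z t s) * eval_form a s * eval_lin (inner g a m) s).
Proof.
  intros Hm Hs. induction m.
  - cbn [ladder]. destruct R0 as [ | R0 ]; [ lia | ].
    replace (S R0 - 1)%nat with R0 by lia.
    assert (H := cder_mult _ _ _ _ _ (cder_hpoly R0 K _ s _ (cder_X s Hs)) (cder_inner_0 s Hs)).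
    cbv beta in H. match type of H with cder _ _ ?v => match goal with |- cder _ _ ?w =>
      replace w with v by ring end end. exact H.
  - cbn [ladder]. assert (IH := IHm ltac:(lia)). clear IHm.
    replace (R0 - S m)%nat with (S (R0 - S (S m))) in * by lia.
    assert (H := cder_plus _ _ _ _ _ IH (cder_mult _ _ _ _ _
      (cder_hpoly (R0 - S (S m)) K _ s _ (cder_X s Hs)) (cder_inner_S m s Hs))).
    cbv beta in H. match type of H with cder _ _ ?v => match goal with |- cder _ _ ?w =>
      replace w with v by ring end end. exact H.
Qed.

(** What the truncation leaves over of the identity
[sum H_k X^k = - log (1 - X) / (1 - X)] and of the geometric series. *)
Definition error (n K : nat) (s : R) : C :=
  (eval_form a s + eval_form b s) * Xof z t s ^ S K
  * (harmonic K * eval_lin (inner g a n) s + eval_lin (penultimate g a b n) s).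

Lemma cder_primitive n K s :
  (0 < s < 1)%R ->
  cder (primitive g a b n K (Xof z t)) s
    (hpoly (S n) K (Xof z t s) * eval_form g s + error n K s).
Proof.
  intros Hs.
  assert (HL := cder_ladder (S n) K n s ltac:(lia) Hs).
  rewrite Nat.sub_diag in HL.
  assert (HP := cder_mult _ _ _ _ _ (cder_lpoly K _ s _ (cder_X s Hs)) (cder_penultimate n s Hs)).
  assert (H := cder_plus _ _ _ _ _ (cder_plus _ _ _ _ _ HL HP) (cder_final n s Hs)).
  cbv beta in H. unfold primitive.
  match type of H with cder _ _ ?v => match goal with |- cder _ _ ?w =>
      replace w with v; [ exact H | ] end end.
  assert (Eb := b_eq P s Hs). fold (Xof z t s) in Eb.
  assert (EF := hpoly_0_closed K (Xof z t s)). assert (EG := gpoly_closed K (Xof z t s)).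
  unfold error.
  set (X := Xof z t s) in *. set (A := eval_form a s) in *. set (B := eval_form b s) in *.
  assert (EA : A = (A + B) * (1 - X)).
  { replace ((A + B) * (1 - X)) with (A - A * X + B * (1 - X)) by ring. rewrite Eb. ring. }
  assert (EB : B = (A + B) * X).
  { replace B with (B * (1 - X) + B * X) at 1 by ring. rewrite Eb. ring. }
  assert (E1 : hpoly 0 K X * A = (A + B) * (lpoly K X - harmonic K * X ^ S K)).
  { rewrite EA at 1. rewrite <- EF. ring. }
  assert (E2 : gpoly K X * A = B - (A + B) * X ^ S K).
  { rewrite EA at 1. rewrite EB at 2.
    replace (gpoly K X * ((A + B) * (1 - X))) with ((A + B) * (gpoly K X * (1 - X))) by ring.
    rewrite EG. ring. }
  replace (hpoly 0 K X * A * eval_lin (inner g a n) s)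
    with ((A + B) * (lpoly K X - harmonic K * X ^ S K) * eval_lin (inner g a n) s)
    by (rewrite <- E1; ring).
  replace (gpoly K X * - A) with (- (B - (A + B) * X ^ S K)) by (rewrite <- E2; ring).
  ring.
Qed.

Lemma psum_deriv n K s :
  (0 < s < 1)%R ->
  cder (fun x => psum z n K (t x)) s (hpoly n K (Xof z t s) * eval_form g s).
Proof.
  intros Hs. induction K.
  - simpl. rewrite Cmult_0_l. apply cder_const.
  - cbn [psum hpoly]. rewrite Cmult_plus_distr_r. apply cder_plus; auto.
    set (y := t s * (1 - t s)).
    replace (harmonic (S K) / INR (S K) ^ n * Xof z t s ^ S K * eval_form g s)
      with (harmonic (S K) / INR (S K) ^ n * RtoC z ^ S K
            * (y ^ S (2 * K) * (eval_form g s * y))).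
    { apply cder_scal. apply cder_beta_poly. now apply (t_deriv P). }
    unfold Xof. fold y. rewrite Cpow_mult_l, <- Cpow_mult_r.
    replace (2 * S K)%nat with (S (S (2 * K))) by lia. simpl (y ^ S (S (2 * K))).
    simpl (y ^ S (2 * K)). ring.
Qed.


Lemma X_le_1 s : (0 <= s <= 1)%R -> (Cmod (Xof z t s) <= 1)%R.
Proof.
  intros Hs. eapply Rle_trans; [ apply (decay P s Hs) | ].
  assert (0 <= (1 - s ^ 2) / (1 + s ^ 2) <= 1)%R; [ | nra ].
  split; [ apply Rdiv_le_0_compat; nra | ]. apply Rle_div_l; nra.
Qed.

Lemma X_le_endpoint s : (0 <= s <= 1)%R -> (Cmod (Xof z t s) <= 4 * (1 - s) ^ 2)%R.
Proof.
  intros Hs. eapply Rle_trans; [ apply (decay P s Hs) | ].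
  assert (0 <= (1 - s ^ 2) / (1 + s ^ 2) <= 2 * (1 - s))%R; [ | nra ].
  split; [ apply Rdiv_le_0_compat; nra | ]. apply Rle_div_l; nra.
Qed.

Lemma X_pow_le s K :
  (0 <= s <= 1)%R -> (Cmod (Xof z t s ^ S K) <= 4 * (1 - s) ^ 2 * / (1 + INR K * s ^ 2))%R.
Proof.
  intros Hs. rewrite Cmod_pow, <- tech_pow_Rmult.
  pose proof (X_le_endpoint s Hs) as H1. pose proof (X_le_1 s Hs) as H2.
  pose proof (Cmod_ge_0 (Xof z t s)) as H0.
  apply Rmult_le_compat; auto; [ now apply pow_le | ].
  assert (H3 : (Cmod (Xof z t s) <= / (1 + s ^ 2))%R).
  { eapply Rle_trans; [ apply (decay P s Hs) | ].
    assert (Hq : (0 <= (1 - s ^ 2) / (1 + s ^ 2) <= / (1 + s ^ 2))%R).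
    { split; [ apply Rdiv_le_0_compat; nra | ]. unfold Rdiv.
      rewrite <- (Rmult_1_l (/ (1 + s ^ 2))) at 2.
      apply Rmult_le_compat_r; [ left; apply Rinv_0_lt_compat |]; nra. }
    assert (Hi : (/ (1 + s ^ 2) <= 1)%R) by (rewrite <- Rinv_1; apply Rinv_le_contravar; nra).
    nra. }
  apply Rle_trans with ((/ (1 + s ^ 2)) ^ K)%R; [ apply pow_incr; auto | ].
  rewrite pow_inv. pose proof (pos_INR K). apply Rinv_le_contravar; [ nra | ].
  (* Bernoulli's inequality *)
  assert (Hq : (0 <= s ^ 2)%R) by apply pow2_ge_0.
  set (q := (s ^ 2)%R) in *. clearbody q. clear - Hq. induction K; [ simpl; lra | ].
  rewrite S_INR, <- tech_pow_Rmult. pose proof (pos_INR K). nra.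
Qed.

(** The simple pole of the forms at 0 is absorbed by the zero of the power series,
and the poles at 1 by two factors [1 - s] of [X]. *)
Lemma error_bound n :
  exists A, (0 <= A)%R /\ forall K s, (0 < s < 1)%R ->
  (Cmod (error n K s) <= A * (Cmod (harmonic K) + 1) * / (1 + INR K * s ^ 2))%R.
Proof.
  pose proof (level_pos P) as HN.
  destruct (eval_form_bound N a HN (a_level P)) as [Ma [HMa Ha]].
  destruct (eval_form_bound N b HN (b_level P)) as [Mb [HMb Hb]].
  destruct (eval_lin_bound N n _ HN (inner_ok n)) as [B [HB Hi]].
  destruct (eval_lin_bound N (S n) _ HN (penultimate_ok n)) as [B' [HB' Hp]].
  exists ((Ma + Mb) * (B + B') * 4)%R. split; [ repeat apply Rmult_le_pos; lra | ].
  intros K s Hs. unfold error. rewrite !Cmod_mult.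
  assert (Hs' : (0 <= s < 1)%R) by lra.
  specialize (Ha s Hs). specialize (Hb s Hs). specialize (Hi s Hs'). specialize (Hp s Hs').
  assert (HX := X_pow_le s K ltac:(lra)).
  assert (T1 := Cmod_triangle (eval_form a s) (eval_form b s)).
  assert (T2 := Cmod_triangle (harmonic K * eval_lin (inner g a n) s) (eval_lin (penultimate g a b n) s)).
  rewrite Cmod_mult in T2.
  pose proof (Cmod_ge_0 (harmonic K)) as Hh.
  assert (U1 : (Cmod (eval_form a s + eval_form b s)%C <= (Ma + Mb) * / (s * (1 - s)))%R) by lra.
  assert (U2 : (Cmod (harmonic K * eval_lin (inner g a n) s + eval_lin (penultimate g a b n) s)%C
                <= (B + B') * (Cmod (harmonic K) + 1) * (s * / (1 - s)))%R).
  { assert (0 <= s * / (1 - s))%R by (apply Rmult_le_pos; [ lra | left; apply Rinv_0_lt_compat; lra ]).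
    set (q := (s * / (1 - s))%R) in *. set (h := Cmod (harmonic K)) in *.
    clearbody q h.
    assert (h * Cmod (eval_lin (inner g a n) s) <= h * (B * q))%R by (apply Rmult_le_compat_l; auto).
    assert (0 <= B * q)%R by nra. assert (0 <= B' * q * h)%R by (repeat apply Rmult_le_pos; auto).
    nra. }
  assert (HI : (0 < / (1 + INR K * s ^ 2))%R).
  { apply Rinv_0_lt_compat. pose proof (pos_INR K). nra. }
  set (I := (/ (1 + INR K * s ^ 2))%R) in *.
  replace ((Ma + Mb) * (B + B') * 4 * (Cmod (harmonic K) + 1) * I)%R
    with ((Ma + Mb) * / (s * (1 - s)) * (4 * (1 - s) ^ 2 * I)
          * ((B + B') * (Cmod (harmonic K) + 1) * (s * / (1 - s))))%R by (field; split; lra).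
  apply Rmult_le_compat; auto using Cmod_ge_0.
  - apply Rmult_le_pos; apply Cmod_ge_0.
  - apply Rmult_le_compat; auto using Cmod_ge_0.
Qed.

Lemma primitive_near_final n K :
  exists A, forall s, (0 <= s < 1)%R ->
  (Cmod (primitive g a b n K (Xof z t) s - eval_lin (final g a b n) s)%C <= A * (s * (1 - s)))%R.
Proof.
  pose proof (level_pos P) as HN.
  (* Each summand is a polynomial in X without constant term times a power
     series: X vanishes doubly at 1, the series at 0. *)
  assert (G : forall (f : C -> C) j v,
    (exists A, (0 <= A)%R /\ forall x, (Cmod x <= 1)%R -> (Cmod (f x) <= A * Cmod x)%R) ->
    lin_ok N (S j) v ->
    exists A, forall s, (0 <= s < 1)%R ->
      (Cmod (f (Xof z t s) * eval_lin v s)%C <= A * (s * (1 - s)))%R).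
  { intros f j v [A [HA Hf]] Hv.
    destruct (eval_lin_bound N j v HN Hv) as [B [HB Hb]].
    exists (A * 4 * B)%R. intros s Hs. rewrite Cmod_mult.
    specialize (Hb s Hs). specialize (Hf _ (X_le_1 s ltac:(lra))).
    assert (HX := X_le_endpoint s ltac:(lra)).
    replace (A * 4 * B * (s * (1 - s)))%R
      with (A * (4 * (1 - s) ^ 2) * (B * (s * / (1 - s))))%R by (field; lra).
    apply Rmult_le_compat; auto using Cmod_ge_0.
    eapply Rle_trans; [ exact Hf | ]. now apply Rmult_le_compat_l. }
  assert (HL : forall m, exists A, forall s, (0 <= s < 1)%R ->
      (Cmod (ladder g a (S n) K (Xof z t) m s) <= A * (s * (1 - s)))%R).
  { induction m.
    - apply (G (hpoly (S n) K) O); [ apply hpoly_bound | apply inner_ok ].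
    - destruct IHm as [A1 H1].
      destruct (G (hpoly (S n - S m) K) (S m) (inner g a (S m))) as [A2 H2];
        [ apply hpoly_bound | apply inner_ok | ].
      exists (A1 + A2)%R. intros s Hs. cbn [ladder].
      eapply Rle_trans; [ apply Cmod_triangle | ]. specialize (H1 s Hs). specialize (H2 s Hs). lra. }
  destruct (HL n) as [A1 H1].
  destruct (G (lpoly K) (S n) (penultimate g a b n)) as [A2 H2];
    [ apply lpoly_bound | apply penultimate_ok | ].
  exists (A1 + A2)%R. intros s Hs. unfold primitive.
  replace (ladder g a (S n) K (Xof z t) n s
    + lpoly K (Xof z t s) * eval_lin (penultimate g a b n) s
    + eval_lin (final g a b n) s - eval_lin (final g a b n) s)
    with (ladder g a (S n) K (Xof z t) n s
    + lpoly K (Xof z t s) * eval_lin (penultimate g a b n) s) by ring.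
  eapply Rle_trans; [ apply Cmod_triangle | ]. specialize (H1 s Hs). specialize (H2 s Hs). lra.
Qed.

Lemma S4_partial_sum r K :
  sum_n (fun j => S4_term r harmonic z (S j)) K = RtoC (2 * Re (psum z r (S K) (t 0%R))).
Proof.
  assert (E : forall k, S4_term r harmonic z (S k) = RtoC (2 * Re
     (harmonic (S k) / INR (S k) ^ r * RtoC z ^ S k * beta_poly (S (2 * k)) (t 0%R)))).
  { intros k. unfold S4_term. rewrite harmonic_real.
    assert (Hk : (0 < INR (S k))%R) by (apply lt_0_INR; lia).
    assert (HC := Binomial_C_pos (4 * S k) (2 * S k)).
    assert (Hp : (0 < INR (S k) ^ r)%R) by now apply pow_lt.
    replace (RtoC (Re (harmonic (S k))) / INR (S k) ^ r * RtoC z ^ S k) with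
      (RtoC (Re (harmonic (S k)) / INR (S k) ^ r * z ^ S k))
      by (rewrite RtoC_mult, RtoC_div, !RtoC_pow by lra; reflexivity).
    rewrite re_scal_l, (Re_beta_poly _ _ (t_start P) (y_start P)).
    replace (S (S (2 * k))) with (2 * S k)%nat by lia.
    replace (2 * (2 * S k))%nat with (4 * S k)%nat by lia.
    rewrite <- !RtoC_pow, <- !RtoC_mult, <- RtoC_div.
    - f_equal. rewrite pow_add, mult_INR. simpl (INR 2). field. repeat split; lra.
    - apply Rgt_not_eq, Rmult_lt_0_compat; auto. now apply pow_lt. }
  induction K.
  - rewrite sum_O, E. cbn [psum]. f_equal. f_equal. f_equal. ring.
  - rewrite sum_Sn, IHK, E. change plus with Cplus. rewrite <- RtoC_plus.
    f_equal. cbn [psum]. rewrite !re_plus. ring.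
Qed.

Lemma psum_0 n K : psum z n K 0 = 0.
Proof. induction K; cbn [psum]; [ reflexivity | rewrite IHK, beta_poly_0; ring ]. Qed.

Lemma psum_continuous n K s :
  (0 <= s <= 1)%R -> continuous (fun x => Re (psum z n K (t x))) s.
Proof.
  intros Hs. destruct (t_smooth P s Hs) as [l Hl].
  assert (H : exists d, cder (fun x => psum z n K (t x)) s d).
  { induction K as [ | K [d IH] ].
    - exists 0. apply (cder_ext (fun _ => 0)); [ reflexivity | apply cder_const ].
    - eexists. cbn [psum]. apply cder_plus; [ exact IH | ].
      apply cder_scal. apply cder_beta_poly. exact Hl. }
  destruct H as [d [H _]].
  apply (@ex_derive_continuous R_AbsRing R_NormedModule). now exists (Re d).
Qed.

(** The mean value inequality on [u, v] for the difference of the two primitives,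
then [u] to 0 and [v] to 1.  At 0 only [psum] remains and at 1 only [V]. *)
Lemma psum_estimate n (V : R) :
  filterlim (fun s => Re (eval_lin (final g a b n) s)) (at_left 1) (locally V) ->
  exists A, forall K,
  (Rabs (Re (psum z (S n) (S K) (t 0%R)) + V)
   <= A * (Cmod (harmonic (S K)) + 1) * / sqrt (INR (S K)))%R.
Proof.
  intros HV.
  destruct (error_bound n) as [A [HA HE]]. exists (4 * A)%R. intros K.
  assert (HK : (0 < INR (S K))%R) by (apply lt_0_INR; lia).
  set (f := fun s => psum z (S n) (S K) (t s) - primitive g a b n (S K) (Xof z t) s).
  assert (Hf : forall s, (0 < s < 1)%R -> cder f s (- error n (S K) s)).
  { intros s Hs. assert (H := cder_minus _ _ s _ _ (psum_deriv (S n) (S K) s Hs)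
      (cder_primitive n (S K) s Hs)).
    match type of H with cder _ _ ?v => replace (- error n (S K) s) with v by ring end.
    exact H. }
  set (c := (A * (Cmod (harmonic (S K)) + 1))%R).
  assert (Hc : (0 <= c)%R).
  { apply Rmult_le_pos; auto. pose proof (Cmod_ge_0 (harmonic (S K))). lra. }
  assert (HM : forall u v, (0 < u)%R -> (u < v)%R -> (v < 1)%R ->
    (Rabs (Re (f v) - Re (f u)) <= 4 * c * / sqrt (INR (S K)))%R).
  { intros u v Hu Huv Hv. apply mean_value_atan with (fun s => - error n (S K) s); auto.
    - intros s Hs. apply Hf. lra.
    - intros s Hs. rewrite Cmod_opp. apply HE. lra. }
  destruct (primitive_near_final n (S K)) as [A1 H1].
  destruct (eval_lin_bound N (S (S n)) _ (level_pos P) (final_ok n)) as [B [HB Hb]].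
  set (u := fun m : nat => (/ (INR m + 3))%R).
  set (v := fun m : nat => (1 - / (INR m + 3))%R).
  assert (Hu : forall m, (0 < u m < 1 / 2)%R).
  { intros m. unfold u. pose proof (pos_INR m). split; [ apply Rinv_0_lt_compat; lra | ].
    unfold Rdiv. rewrite Rmult_1_l. apply Rinv_lt_contravar; lra. }
  assert (Hu1 : forall m, (0 <= u m < 1)%R) by (intros m; specialize (Hu m); lra).
  assert (Huv : forall m, (u m < v m < 1)%R).
  { intros m. specialize (Hu m). unfold v. fold (u m). lra. }
  assert (Hv1 : forall m, (0 <= v m < 1)%R).
  { intros m. specialize (Hu m). specialize (Huv m). lra. }
  assert (Lu : is_lim_seq u 0%R).
  { apply is_lim_seq_0_dominated with (fun k => / (INR k + 1))%R.
    - intros m. rewrite Rabs_pos_eq by (left; apply Hu). unfold u. pose proof (pos_INR m).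
      apply Rinv_le_contravar; lra.
    - apply (is_lim_seq_ext (fun k => / INR (S k))%R); [ intros; now rewrite S_INR | ].
      apply (is_lim_seq_incr_1 (fun k => / INR k)%R).
      apply (is_lim_seq_inv _ p_infty); [ apply is_lim_seq_INR | discriminate ]. }
  assert (Lv : is_lim_seq v 1%R).
  { replace 1%R with (1 - 0)%R at 1 by ring. apply is_lim_seq_minus'; auto. apply is_lim_seq_const. }
  assert (Lv' : filterlim v eventually (at_left 1)).
  { intros Q HQ. destruct (Lv _ HQ) as [M HM']. exists M. intros m Hm.
    apply HM'; auto. apply Huv. }
  assert (Hsmall : forall w : nat -> R, (forall m, 0 <= w m < 1)%R ->
    is_lim_seq (fun m => w m * (1 - w m))%R 0%R ->
    is_lim_seq (fun m => Re (primitive g a b n (S K) (Xof z t) (w m))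
                         - Re (eval_lin (final g a b n) (w m)))%R 0%R).
  { intros w Hw Lw. apply is_lim_seq_0_dominated with (fun m => A1 * (w m * (1 - w m)))%R.
    - intros m. eapply Rle_trans; [ | apply (H1 (w m) (Hw m)) ].
      eapply Rle_trans; [ | apply re_le_Cmod ]. apply Req_le. f_equal.
    - replace (Finite 0%R) with (Rbar_mult A1 0%R) by (simpl; f_equal; ring).
      now apply is_lim_seq_scal_l. }
  assert (Lu2 : is_lim_seq (fun m => u m * (1 - u m))%R 0%R).
  { replace 0%R with (0 * (1 - 0))%R by ring. apply is_lim_seq_mult'; auto.
    apply is_lim_seq_minus'; auto. apply is_lim_seq_const. }
  assert (Lv2 : is_lim_seq (fun m => v m * (1 - v m))%R 0%R).
  { replace 0%R with (1 * (1 - 1))%R by ring. apply is_lim_seq_mult'; auto.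
    apply is_lim_seq_minus'; auto. apply is_lim_seq_const. }
  assert (F0 : is_lim_seq (fun m => Re (f (u m))) (Re (psum z (S n) (S K) (t 0%R)))).
  { assert (L1 : is_lim_seq (fun m => Re (psum z (S n) (S K) (t (u m))))
                   (Re (psum z (S n) (S K) (t 0%R)))).
    { apply (is_lim_seq_comp_filterlim (fun x => Re (psum z (S n) (S K) (t x))) _ (locally 0%R)); auto.
      apply (psum_continuous (S n) (S K) 0). lra. }
    assert (L2 := Hsmall u Hu1 Lu2).
    assert (L3 : is_lim_seq (fun m => Re (eval_lin (final g a b n) (u m))) 0%R).
    { apply is_lim_seq_0_dominated with (fun m => B * (2 * u m))%R.
      - intros m. specialize (Hu m).
        eapply Rle_trans; [ apply re_le_Cmod | ].
        eapply Rle_trans; [ apply Hb; lra | ]. apply Rmult_le_compat_l; auto.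
        rewrite Rmult_comm. apply Rmult_le_compat_r; [ lra | ].
        apply Rle_trans with (/ (/ 2))%R; [ apply Rinv_le_contravar; lra | rewrite Rinv_inv; lra ].
      - replace 0%R with (B * (2 * 0))%R by ring.
        apply (is_lim_seq_scal_l _ B (2 * 0)%R). now apply (is_lim_seq_scal_l _ 2%R 0%R). }
    assert (L := is_lim_seq_minus' _ _ _ _ L1 (is_lim_seq_plus' _ _ _ _ L2 L3)).
    rewrite Rplus_0_r, Rminus_0_r in L.
    eapply is_lim_seq_ext; [ | exact L ]. intros m. unfold f.
    rewrite Re_minus. ring. }
  assert (F1 : is_lim_seq (fun m => Re (f (v m))) (- V)%R).
  { assert (L1 : is_lim_seq (fun m => Re (psum z (S n) (S K) (t (v m)))) 0%R).
    { replace 0%R with (Re (psum z (S n) (S K) (t 1%R)))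
        by (rewrite (t_end P), psum_0; reflexivity).
      apply (is_lim_seq_comp_filterlim (fun x => Re (psum z (S n) (S K) (t x))) _ (locally 1%R)); auto.
      apply (psum_continuous (S n) (S K) 1). lra. }
    assert (L2 := Hsmall v Hv1 Lv2).
    assert (L3 := is_lim_seq_comp_filterlim _ V _ _ HV Lv').
    assert (L := is_lim_seq_minus' _ _ _ _ L1 (is_lim_seq_plus' _ _ _ _ L2 L3)).
    replace (0 - (0 + V))%R with (- V)%R in L by ring.
    eapply is_lim_seq_ext; [ | exact L ]. intros m. unfold f.
    rewrite Re_minus. ring. }
  assert (F := is_lim_seq_abs _ _ (is_lim_seq_minus' _ _ _ _ F1 F0)).
  replace (4 * A * (Cmod (harmonic (S K)) + 1))%R with (4 * c)%R by (unfold c; ring).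
  assert (R1 := is_lim_seq_le _ (fun _ => 4 * c * / sqrt (INR (S K)))%R _ _
    (fun m => HM (u m) (v m) (proj1 (Hu m)) (proj1 (Huv m)) (proj2 (Huv m))) F (is_lim_seq_const _)).
  set (p := Re (psum z (S n) (S K) (t 0%R))) in *.
  change (Rabs (- V - p) <= 4 * c * / sqrt (INR (S K)))%R in R1.
  replace (p + V)%R with (- (- V - p))%R by ring. now rewrite Rabs_Ropp.
Qed.

Theorem S4_harmonic_is_CMZV n :
  exists s, is_S4 (S n) harmonic z s /\ CMZV (S n + 2) N s.
Proof.
  pose proof (level_pos P) as HN.
  destruct (eval_lin_limit N _ _ HN (final_ok n)) as [V [HV HC]].
  { intros c w Hin. eapply (admissible_integrate N); [ | | | exact Hin ].
    - apply (b_level P).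
    - apply (b_regular P).
    - apply penultimate_ok. }
  exists (RtoC (-2 * V)). split.
  2:{ now replace (S n + 2)%nat with (S (S (S n))) by lia. }
  apply Clim_filterlim.
  destruct (psum_estimate n V HV) as [A HA].
  assert (L : is_lim_seq (fun K => Re (psum z (S n) (S K) (t 0%R)) + V)%R 0%R).
  { eapply is_lim_seq_0_dominated; [ exact HA | apply harmonic_over_sqrt ]. }
  split.
  - assert (L' := is_lim_seq_scal_l _ 2 _ (is_lim_seq_minus' _ _ _ _ L (is_lim_seq_const V))).
    replace (Rbar_mult 2 (Finite (0 - V))) with (Finite (Re (RtoC (-2 * V)))) in L'
      by (simpl; f_equal; ring).
    eapply is_lim_seq_ext; [ | exact L' ]. intros K. cbv beta.
    rewrite S4_partial_sum, re_RtoC. ring.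
  - rewrite im_RtoC. eapply is_lim_seq_ext; [ | apply is_lim_seq_const ]. intros K.
    now rewrite S4_partial_sum, im_RtoC.
Qed.
End SeriesAlongPath.

(** * Rational identities along the paths *)

Lemma Ci_sqr : Ci * Ci = -1.
Proof. unfold Ci, RtoC, Cmult, Copp; simpl. f_equal; ring. Qed.

(** Used for roots of a quadratic polynomial with simple coefficients, so that the
roots themselves disappear from the rational identities. *)
Lemma eta_pair s1 s2 e p (s : R) :
  1 - s1 * s <> 0 -> 1 - s2 * s <> 0 -> s1 + s2 = e -> s1 * s2 = p ->
  1 - e * s + p * s ^ 2 <> 0 /\
  eta (Pole s1) s + eta (Pole s2) s = (e - 2 * p * s) / (1 - e * s + p * s ^ 2).
Proof.
  intros H1 H2 <- <-.
  assert (E : 1 - (s1 + s2) * s + s1 * s2 * s ^ 2 = (1 - s1 * s) * (1 - s2 * s)) by ring.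
  rewrite E. split; [ now apply Cmult_neq_0 | ]. simpl. field. auto.
Qed.

Lemma cder_inv_1_plus_sqr s :
  cder (fun x => RtoC (/ (1 + x ^ 2))) s (RtoC (- (2 * s) * (/ (1 + s ^ 2)) ^ 2)).
Proof.
  apply cder_real. assert (0 <= s ^ 2)%R by apply pow2_ge_0.
  auto_derive; [ nra | ]. field. nra.
Qed.

(** Most denominators below have a nonzero real part. *)
Ltac neq0 := intros E; apply (f_equal Re) in E; unfold Re in E; simpl in E; nra.

(** Tells the letters [Pole sigma] of [b] from [Pole 1]: there [sigma] is not real.
The value at [Zero] only has to differ from 0. *)
Definition pole_Im (x : letter) : R := match x with Zero => 1 | Pole sigma => Im sigma end.

(** * The path of level 8 *)

(** The denominator is kept as a real factor: its inverse has a real derivative. *)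
Definition t8 (s : R) : C := / 2 * ((1 - s) * (1 - s)) * RtoC (/ (1 + s ^ 2)).

Definition zeta8 : C := (sqrt 2 / 2, sqrt 2 / 2)%R.
Definition zeta8' : C := (sqrt 2 / 2, - (sqrt 2 / 2))%R.

Lemma zeta8_sqr : zeta8 * zeta8 = Ci.
Proof.
  assert (H := sqrt_sqrt 2 ltac:(lra)).
  unfold zeta8, Ci, Cmult; simpl. f_equal; [ ring | ].
  replace (sqrt 2 / 2 * (sqrt 2 / 2) + sqrt 2 / 2 * (sqrt 2 / 2))%R with (sqrt 2 * sqrt 2 / 2)%R by field.
  lra.
Qed.

Lemma zeta8'_sqr : zeta8' * zeta8' = - Ci.
Proof.
  assert (H := sqrt_sqrt 2 ltac:(lra)).
  unfold zeta8', Ci, Cmult, Copp; simpl. f_equal; [ ring | ].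
  replace (sqrt 2 / 2 * - (sqrt 2 / 2) + - (sqrt 2 / 2) * (sqrt 2 / 2))%R with (- (sqrt 2 * sqrt 2 / 2))%R by field.
  lra.
Qed.

Definition g8 : form := ((-2)%Z, Pole 1) :: ((2)%Z, Pole (-1)) :: nil.
Definition a8 : form :=
  ((4)%Z, Pole 1) :: ((4)%Z, Pole (-1)) :: ((-4)%Z, Pole Ci) :: ((-4)%Z, Pole (- Ci)) :: nil.
Definition b8 : form :=
  ((2)%Z, Zero) :: ((-1)%Z, Pole zeta8) :: ((-1)%Z, Pole (- zeta8))
  :: ((-1)%Z, Pole zeta8') :: ((-1)%Z, Pole (- zeta8'))
  :: ((4)%Z, Pole Ci) :: ((4)%Z, Pole (- Ci)) :: nil.

Lemma pow8_of_sqr z : z * z = Ci \/ z * z = - Ci -> z ^ 8 = 1.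
Proof.
  intros H. replace (z ^ 8) with ((z * z) ^ 4) by ring.
  destruct H as [-> | ->]; ring [Ci_sqr].
Qed.

Lemma t8_cder s :
  cder t8 s (/ 2 * (- (2) * (1 - s)) * RtoC (/ (1 + s ^ 2))
             + / 2 * ((1 - s) * (1 - s)) * RtoC (- (2 * s) * (/ (1 + s ^ 2)) ^ 2)).
Proof.
  assert (H1 : cder (fun x => 1 - RtoC x) s (0 - 1)).
  { apply cder_minus; [ apply cder_const | apply cder_RtoC ]. }
  assert (H := cder_mult _ _ s _ _ (cder_scal (/ 2) _ s _ (cder_mult _ _ s _ _ H1 H1))
                 (cder_inv_1_plus_sqr s)).
  cbv beta in H. unfold t8.
  match type of H with cder _ _ ?v => match goal with |- cder _ _ ?w =>
    replace w with v by ring end end. exact H.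
Qed.

Lemma RtoC_inv_1_plus_sqr s : RtoC (/ (1 + s ^ 2)) = / (1 + RtoC s ^ 2).
Proof.
  rewrite RtoC_inv, RtoC_plus, RtoC_pow; auto. assert (0 <= s ^ 2)%R by apply pow2_ge_0. lra.
Qed.

Lemma RtoC_deriv_inv s :
  RtoC (- (2 * s) * (/ (1 + s ^ 2)) ^ 2) = - (2 * s) * (/ (1 + RtoC s ^ 2)) ^ 2.
Proof.
  rewrite RtoC_mult, RtoC_pow, RtoC_inv_1_plus_sqr, RtoC_opp, RtoC_mult. reflexivity.
Qed.

Lemma parametrization8 : parametrization 8 16 t8 g8 a8 b8.
Proof.
  assert (Z1 : zeta8 ^ 8 = 1) by (apply pow8_of_sqr; left; apply zeta8_sqr).
  assert (Z2 : zeta8' ^ 8 = 1) by (apply pow8_of_sqr; right; apply zeta8'_sqr).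
  assert (Z3 : (- zeta8) ^ 8 = 1) by (rewrite <- Z1; ring).
  assert (Z4 : (- zeta8') ^ 8 = 1) by (rewrite <- Z2; ring).
  assert (E1 : (-1 : C) ^ 8 = 1) by ring.
  assert (Ei : Ci ^ 8 = 1) by ring [Ci_sqr].
  assert (Emi : (- Ci) ^ 8 = 1) by ring [Ci_sqr].
  assert (Hy : forall s, t8 s * (1 - t8 s) = (1 - RtoC s ^ 2) ^ 2 / (4 * (1 + RtoC s ^ 2) ^ 2)).
  { intros s. unfold t8. rewrite RtoC_inv_1_plus_sqr. field. neq0. }
  assert (Ha : forall s, (0 < s < 1)%R ->
    eval_form a8 s = 8 * s / (1 - RtoC s ^ 2) + 8 * s / (1 + RtoC s ^ 2)).
  { intros s Hs. unfold eval_form, a8; cbn [fold_right fst snd eta].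
    field [Ci_sqr]. repeat split; neq0. }
  assert (Hb : forall s, (0 < s < 1)%R ->
    eval_form b8 s = 2 / s + 4 * s ^ 3 / (1 + RtoC s ^ 4) - 8 * s / (1 + RtoC s ^ 2)).
  { intros s Hs.
    assert (R8 : forall z, z ^ 8 = 1 -> 1 - z * s <> 0).
    { intros z Hz. apply (one_minus_neq_0 8); auto; [ lia | lra ]. }
    destruct (eta_pair zeta8 (- zeta8) 0 (- Ci) s) as [N1 P1]; auto; try ring [zeta8_sqr].
    destruct (eta_pair zeta8' (- zeta8') 0 Ci s) as [N2 P2]; auto; try ring [zeta8'_sqr].
    unfold eval_form, b8; cbn [fold_right fst snd].
    match goal with |- ?l = _ => replace l with (2 * eta Zero s
      - (eta (Pole zeta8) s + eta (Pole (- zeta8)) s)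
      - (eta (Pole zeta8') s + eta (Pole (- zeta8')) s)
      + 4 * eta (Pole Ci) s + 4 * eta (Pole (- Ci)) s) by ring end.
    rewrite P1, P2. cbn [eta].
    field [Ci_sqr]. repeat split; auto; neq0. }
  constructor.
  - lia.
  - intros c x [E | [E | []]]; injection E; intros; subst; cbn [is_letter]; auto. apply Cpow_1_l.
  - intros c x [E | [E | [E | [E | []]]]]; injection E; intros; subst; cbn [is_letter]; auto.
    apply Cpow_1_l.
  - intros c x [E | [E | [E | [E | [E | [E | [E | []]]]]]]];
      injection E; intros; subst; cbn [is_letter]; auto.
  - intros c [E | [E | []]]; discriminate.
  - assert (0 < sqrt 2)%R by (apply sqrt_lt_R0; lra).
    intros c [E | [E | [E | [E | [E | [E | [E | []]]]]]]];
      apply (f_equal (fun p => pole_Im (snd p))) in E; simpl in E; lra.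
  - intros s _. eexists. apply t8_cder.
  - intros s Hs. assert (H := t8_cder s).
    match type of H with cder _ _ ?v => match goal with |- cder _ _ ?w =>
      replace w with v; [ exact H | ] end end.
    rewrite Hy, RtoC_deriv_inv, RtoC_inv_1_plus_sqr.
    unfold eval_form, g8; cbn [fold_right fst snd eta].
    field. repeat split; neq0.
  - intros s Hs. rewrite Ha by auto. unfold t8. rewrite RtoC_inv_1_plus_sqr.
    unfold eval_form, g8; cbn [fold_right fst snd eta].
    field. repeat split; neq0.
  - intros s Hs. rewrite Ha, Hb, Hy by auto. field. repeat split; neq0.
  - intros s Hs. rewrite Hy.
    set (q := ((1 - s ^ 2) / (1 + s ^ 2))%R).
    assert (Hs2 : (0 <= s ^ 2)%R) by apply pow2_ge_0.
    assert (Hq : (0 <= q <= 1)%R).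
    { unfold q. split; [ apply Rdiv_le_0_compat; nra | apply Rle_div_l; nra ]. }
    replace (16 * ((1 - RtoC s ^ 2) ^ 2 / (4 * (1 + RtoC s ^ 2) ^ 2)) ^ 2) with (RtoC (q ^ 4)).
    + rewrite Cmod_R, Rabs_pos_eq by (apply pow_le; lra).
      replace (q ^ 4)%R with (q ^ 2 * q ^ 2)%R by ring.
      assert (0 <= q ^ 2 <= 1)%R by nra. nra.
    + unfold q. rewrite RtoC_pow, RtoC_div, RtoC_minus, RtoC_plus, RtoC_pow by lra.
      field. neq0.
  - unfold t8, Re. simpl. field.
  - rewrite Hy. unfold Im. simpl. field.
  - unfold t8. replace (1 - RtoC 1) with (RtoC 0) by ring. ring.
Qed.

(** * The path of level 12 *)

(** [(1 - i) (1 - s) / (2 (1 + i s))], with a real denominator. *)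
Definition t12 (s : R) : C :=
  (1 - Ci) / 2 * ((1 - s) * (1 - Ci * s)) * RtoC (/ (1 + s ^ 2)).

(** [i] times the primitive cube roots of unity: the inverses of the zeros of
[1 + i s - s^2], a factor of [1 - X]. *)
Definition rho1 : C := (- (sqrt 3 / 2), - (1 / 2))%R.
Definition rho2 : C := (sqrt 3 / 2, - (1 / 2))%R.

Lemma rho_sum : rho1 + rho2 = - Ci.
Proof. unfold rho1, rho2, Ci, Cplus, Copp; simpl. f_equal; field. Qed.

Lemma rho_prod : rho1 * rho2 = -1.
Proof.
  assert (H := sqrt_sqrt 3 ltac:(lra)).
  unfold rho1, rho2, Cmult, RtoC; simpl. f_equal; [ | ring ].
  replace (- (sqrt 3 / 2) * (sqrt 3 / 2) - - (1 / 2) * - (1 / 2))%R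
    with (- (sqrt 3 * sqrt 3 / 4) - 1 / 4)%R by field. lra.
Qed.

Lemma pow12_of_root z : z * z = 1 - Ci * z -> z ^ 12 = 1.
Proof.
  intros H.
  assert (H3 : z ^ 3 = - Ci).
  { replace (z ^ 3) with (z * (z * z)) by ring. rewrite H.
    replace (z * (1 - Ci * z)) with (z - Ci * (z * z)) by ring. rewrite H. ring [Ci_sqr]. }
  replace (z ^ 12) with ((z ^ 3) ^ 4) by ring. rewrite H3. ring [Ci_sqr].
Qed.

Definition g12 : form := ((-1)%Z, Pole 1) :: (1%Z, Pole (-1)) :: nil.
Definition a12 : form :=
  (2%Z, Pole 1) :: (2%Z, Pole (-1)) :: ((-4)%Z, Pole (- Ci)) :: nil.
Definition b12 : form :=
  (1%Z, Zero) :: ((-1)%Z, Pole rho1) :: ((-1)%Z, Pole rho2) :: (4%Z, Pole (- Ci)) :: nil.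

Lemma t12_cder s :
  cder t12 s ((1 - Ci) / 2 * (- (1 - Ci * s) - Ci * (1 - s)) * RtoC (/ (1 + s ^ 2))
             + (1 - Ci) / 2 * ((1 - s) * (1 - Ci * s))
               * RtoC (- (2 * s) * (/ (1 + s ^ 2)) ^ 2)).
Proof.
  assert (H1 : cder (fun x => 1 - RtoC x) s (0 - 1)).
  { apply cder_minus; [ apply cder_const | apply cder_RtoC ]. }
  assert (H2 : cder (fun x => 1 - Ci * RtoC x) s (0 - Ci * 1)).
  { apply cder_minus; [ apply cder_const | apply cder_scal, cder_RtoC ]. }
  assert (H := cder_mult _ _ s _ _ (cder_scal ((1 - Ci) / 2) _ s _ (cder_mult _ _ s _ _ H1 H2))
                 (cder_inv_1_plus_sqr s)).
  cbv beta in H. unfold t12.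
  match type of H with cder _ _ ?v => match goal with |- cder _ _ ?w =>
    replace w with v by ring end end. exact H.
Qed.

Lemma parametrization12 : parametrization 12 4 t12 g12 a12 b12.
Proof.
  assert (Q1 : rho1 ^ 12 = 1).
  { apply pow12_of_root.
    replace (rho1 * rho1) with (rho1 * (rho1 + rho2) - rho1 * rho2) by ring.
    rewrite rho_sum, rho_prod. ring. }
  assert (Q2 : rho2 ^ 12 = 1).
  { apply pow12_of_root.
    replace (rho2 * rho2) with (rho2 * (rho1 + rho2) - rho1 * rho2) by ring.
    rewrite rho_sum, rho_prod. ring. }
  assert (E1 : (-1 : C) ^ 12 = 1) by ring.
  assert (Ei : Ci ^ 12 = 1) by ring [Ci_sqr].
  assert (Emi : (- Ci) ^ 12 = 1) by ring [Ci_sqr].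
  assert (Hden : forall s : R, 1 + RtoC s ^ 2 <> 0) by (intros s; neq0).
  assert (Hi : forall s : R, 1 + Ci * s <> 0).
  { intros s. neq0. }
  assert (Hy : forall s : R, t12 s * (1 - t12 s) = (1 - RtoC s ^ 2) / (2 * (1 + Ci * s) ^ 2)).
  { intros s. unfold t12. rewrite RtoC_inv_1_plus_sqr. field [Ci_sqr]. auto. }
  assert (Ha : forall s, (0 < s < 1)%R ->
    eval_form a12 s = 4 * s / (1 - RtoC s ^ 2) + 4 * Ci / (1 + Ci * s)).
  { intros s Hs. unfold eval_form, a12; cbn [fold_right fst snd eta].
    field. repeat split; auto; neq0. }
  assert (Hb : forall s, (0 < s < 1)%R ->
    1 + Ci * s - RtoC s ^ 2 <> 0 /\
    eval_form b12 s = / s - (2 * s - Ci) / (1 + Ci * s - RtoC s ^ 2) - 4 * Ci / (1 + Ci * s)).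
  { intros s Hs.
    assert (R12 : forall z, z ^ 12 = 1 -> 1 - z * s <> 0).
    { intros z Hz. apply (one_minus_neq_0 12); auto; [ lia | lra ]. }
    destruct (eta_pair rho1 rho2 (- Ci) (-1) s) as [N1 P1]; auto using rho_sum, rho_prod.
    replace (1 - - Ci * s + -1 * RtoC s ^ 2) with (1 + Ci * s - RtoC s ^ 2) in N1, P1 by ring.
    split; auto.
    unfold eval_form, b12; cbn [fold_right fst snd].
    match goal with |- ?l = _ => replace l with (eta Zero s
      - (eta (Pole rho1) s + eta (Pole rho2) s) + 4 * eta (Pole (- Ci)) s) by ring end.
    rewrite P1. cbn [eta]. field. repeat split; auto; neq0. }
  constructor.
  - lia.
  - intros c x [E | [E | []]]; injection E; intros; subst; cbn [is_letter]; auto. apply Cpow_1_l.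
  - intros c x [E | [E | [E | []]]]; injection E; intros; subst; cbn [is_letter]; auto.
    apply Cpow_1_l.
  - intros c x [E | [E | [E | [E | []]]]];
      injection E; intros; subst; cbn [is_letter]; auto.
  - intros c [E | [E | []]]; discriminate.
  - intros c [E | [E | [E | [E | []]]]];
      apply (f_equal (fun p => pole_Im (snd p))) in E; simpl in E; lra.
  - intros s _. eexists. apply t12_cder.
  - intros s Hs. assert (H := t12_cder s).
    match type of H with cder _ _ ?v => match goal with |- cder _ _ ?w =>
      replace w with v; [ exact H | ] end end.
    rewrite Hy, RtoC_deriv_inv, RtoC_inv_1_plus_sqr.
    unfold eval_form, g12; cbn [fold_right fst snd eta].
    field [Ci_sqr]. repeat split; auto; neq0.
  - intros s Hs. rewrite Ha by auto. unfold t12. rewrite RtoC_inv_1_plus_sqr.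
    unfold eval_form, g12; cbn [fold_right fst snd eta].
    field [Ci_sqr]. repeat split; auto; neq0.
  - intros s Hs. destruct (Hb s Hs) as [Hn ->]. rewrite Ha, Hy by auto.
    field [Ci_sqr]. repeat split; auto; neq0.
  - intros s Hs. rewrite Hy.
    assert (Hs2 : (0 <= s ^ 2)%R) by apply pow2_ge_0.
    assert (Hm : (Cmod (1 + Ci * s)%C ^ 2 = 1 + s ^ 2)%R).
    { rewrite Cmod2_alt. unfold Re, Im. simpl. ring. }
    replace (4 * ((1 - RtoC s ^ 2) / (2 * (1 + Ci * s) ^ 2)) ^ 2)
      with ((RtoC (1 - s ^ 2) / (1 + Ci * s) ^ 2) ^ 2)
      by (rewrite RtoC_minus, RtoC_pow; field; auto).
    rewrite Cmod_pow, Cmod_div, Cmod_R, Cmod_pow, Hm by now apply Cpow_nz.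
    rewrite Rabs_pos_eq by nra. apply Rle_refl.
  - unfold t12, Re. simpl. field.
  - rewrite Hy. unfold Im. simpl. field.
  - unfold t12. replace (1 - RtoC 1) with (RtoC 0) by ring. ring.
Qed.

(** * The two evaluations *)

Theorem corollary1p8 :
  forall r : nat, (0 < r)%nat ->
    (exists s : C, is_S4 r harmonic (2 ^ 4)%C s /\ CMZV (r + 2) 8 s)
    /\ (exists s : C, is_S4 r harmonic (2 ^ 2)%C s /\ CMZV (r + 2) 12 s).
Proof.
  intros [ | n ] Hr; [ lia | ].
  replace ((2 ^ 4)%C) with (RtoC 16) by (rewrite <- RtoC_pow; f_equal; ring).
  replace ((2 ^ 2)%C) with (RtoC 4) by (rewrite <- RtoC_pow; f_equal; ring).
  split.
  - apply (S4_harmonic_is_CMZV _ _ _ _ _ _ parametrization8).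
  - apply (S4_harmonic_is_CMZV _ _ _ _ _ _ parametrization12).
Qed.
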